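(* Let $(p_n)_{n\in\mathbb N}$ be a sequence in $\mathbb N^{\mathbb N}$ with $p_{n+1}<_{\mathrm T}p_n$ for all $n\in\mathbb N$ and $\langle p_1,p_2,p_3,\dots\rangle<_{\mathrm T}p_0$ (such a sequence exists), and let $a_n:=\deg(p_n)$ be the Turing degree of $p_n$. Consider the problem $f:\subseteq\mathcal D\rightrightarrows\mathcal D$ on the set $\mathcal D$ of Turing degrees with $\mathrm{dom}(f)=\{0\}\cup\{a_n:n\in\mathbb N\}$ (where $0$ is the degree of computable sequences) given by \[f(a):=\begin{cases}a_0&\text{if }a=a_0,\\ a_n&\text{if }a=a_{n+1},\\ \{a_n:n\in\mathbb N\}&\text{if }a=0.\end{cases}\] Then $f^\infty\not\le_{\mathrm W}f^\omega$ and $f^\omega\equiv_{\mathrm{sW}}\widehat{f^\diamond}$.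
   Context: Problems. A represented space $(X,\delta_X)$ is a set $X$ with a surjective partial map $\delta_X:\subseteq\mathbb N^{\mathbb N}\to X$. A partial function $F:\subseteq\mathbb N^{\mathbb N}\to\mathbb N^{\mathbb N}$ is computable if there is a computable monotone (w.r.t. the prefix order) word function $\varphi:\mathbb N^*\to\mathbb N^*$ with $F(p)=\sup_{w\sqsubseteq p}\varphi(w)$ for all $p\in\mathrm{dom}(F)$. For a partial multivalued function $f:\subseteq X\rightrightarrows Y$ between represented spaces, $F:\subseteq\mathbb N^{\mathbb N}\to\mathbb N^{\mathbb N}$ is a realizer of $f$, written $F\vdash f$, if $\delta_YF(p)\in f\delta_X(p)$ for all $p\in\mathrm{dom}(f\delta_X)$. A problem is a multivalued function with a realizer. Composition: $g\circ f(x)=\{z:(\exists y\in f(x))\,z\in g(y)\}$ with $\mathrm{dom}(g\circ f)=\{x\in\mathrm{dom}(f):f(x)\subseteq\mathrm{dom}(g)\}$. The realizer version of $f$ is $f^{\mathrm r}:=\delta_Y^{-1}\circ f\circ\delta_X:\subseteq\mathbb N^{\mathbb N}\rightrightarrows\mathbb N^{\mathbb N}$. The set $\mathcal D$ of Turing degrees is represented by $\deg:\mathbb N^{\mathbb N}\to\mathcal D$, $\deg(p)=\{q\in\mathbb N^{\mathbb N}:q\equiv_{\mathrm T}p\}$. Tupling. $\langle q,p\rangle:=q(0)p(0)q(1)p(1)\dots$; $\langle p_0,p_1,\dots\rangle$ is the standard countable tupling, e.g. $\langle p_0,p_1,\dots\rangle(\langle i,j\rangle)=p_i(j)$, and $\langle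 q_0,\dots,q_k\rangle$ is a standard finite tupling. $\langle\mathrm{id}\times f\rangle$ is the problem $\langle q,p\rangle\mapsto\{\langle q,r\rangle:r\in f(p)\}$. Universal function. $\Phi$ is a fixed standard total representation of a set of continuous partial functions on $\mathbb N^{\mathbb N}$ (with natural domains), where a name $q$ encodes the graph of a monotone word function approximating $\Phi_q$; $\mathsf U_q:=\Phi_q$, and $\mathsf U\langle q,p\rangle:=\mathsf U_q(p)$ is a computable partial function. The smn-theorem holds: for every computable (continuous) $F:\subseteq\mathbb N^{\mathbb N}\to\mathbb N^{\mathbb N}$ there is a total computable (continuous) $S$ with $\mathsf U_{S(q)}(p)=F\langle q,p\rangle$ for all $\langle q,p\rangle\in\mathrm{dom}(F)$. The names $q$ allow the digits $0,1,2$ as dummy symbols: adding or removing them does not change $\mathsf U_q$. Operators, for $f:\subseteq\mathbb N^{\mathbb N}\rightrightarrows\mathbb N^{\mathbb N}$ (for other problems $f$ apply the operators $f^\infty,f^\diamond,f^\omega$ to $f^{\mathrm r}$). Put $L_f:=\mathsf U\circ\langle\mathrm{id}\times f\rangle$. Infinite loop: $f^\infty(q_0):=\{\langle q_0,q_1,\dots\rangle:(\forall i)\ q_{i+1}\in L_f(q_i)\}$, with $\mathrm{dom}(f^\infty)$ the set of $q_0$ such that $A_0:=\{q_0\}\subseteq\mathrm{dom}(L_f)$ and $A_{i+1}:=L_f(A_i)\subseteq\mathrm{dom}(L_f)$ for all $i$. Diamond: a finite run is $\langle q_0,\dots,q_k\rangle$ with $q_{i+1}\in L_f(q_i)$ for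 all $i<k$; an infinite run is $\langle q_0,q_1,\dots\rangle$ with this for all $i$. A finite run is successful if $q_k(0)=0$ and $q_i(0)\ne0$ for all $i<k$; it stalls if $q_k\notin\mathrm{dom}(L_f)$ and $q_i(0)\ne0$ for all $i\le k$; an infinite run is unsuccessful if $q_i(0)\ne0$ for all $i$. $f^\diamond(q_0)$ is the set of all $q_k$ such that there are $q_1,\dots,q_{k-1}$ with $\langle q_0,\dots,q_k\rangle$ a successful finite run; $\mathrm{dom}(f^\diamond)$ is the set of $q_0$ such that no run starting with $q_0$ stalls or is infinite and unsuccessful. Omega: $f^{[0]}:=\mathrm{id}$, $f^{[1]}:=\langle\mathrm{id}\times f\rangle$, $f^{[n+1]}:=\langle\mathrm{id}\times f\rangle\circ\mathsf U\circ f^{[n]}$ for $n\ge1$, and $f^\omega(p):=\langle f^{[0]}(p),f^{[1]}(p),f^{[2]}(p),\dots\rangle=\{\langle r_0,r_1,\dots\rangle:(\forall n)\ r_n\in f^{[n]}(p)\}$ for all $p$ with $p\in\mathrm{dom}(f^{[n]})$ for all $n$. Parallelization: for $g:\subseteq X\rightrightarrows Y$, $\widehat g:\subseteq X^{\mathbb N}\rightrightarrows Y^{\mathbb N}$, $(x_i)_i\mapsto\prod_ig(x_i)$. Reducibilities. $f\le_{\mathrm W}g$ if there are computable $H,K:\subseteq\mathbb N^{\mathbb N}\to\mathbb N^{\mathbb N}$ with $H\langle\mathrm{id},GK\rangle\vdash f$ whenever $G\vdash g$; $f\le_{\mathrm{sW}}g$ if there are computable $H,K$ with $HGK\vdash f$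 whenever $G\vdash g$; $\equiv_{\mathrm{sW}}$ is the induced equivalence. *)

(* Defs.v *)
From mathcomp Require Import all_boot.
From mathcomp Require Import boolp classical_sets.

Set Implicit Arguments.
Unset Strict Implicit.
Unset Printing Implicit Defensive.

Local Open Scope classical_set_scope.

(* A bijection between nat * nat and nat; it is the one underlying
   CodeSeq.code : seq nat -> nat, since
   CodeSeq.code (x :: s) = (npair x (CodeSeq.code s)).+1. *)
Definition npair (x y : nat) : nat := (2 ^ x * y.*2.+1).-1.
Definition nfst (n : nat) : nat := logn 2 n.+1.
Definition nsnd (n : nat) : nat := (n.+1 %/ 2 ^ nfst n)./2.

Lemma npairS x y : (npair x y).+1 = 2 ^ x * y.*2.+1.
Proof. by rewrite /npair prednK // muln_gt0 expn_gt0. Qed.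

Lemma npairK1 x y : nfst (npair x y) = x.
Proof.
rewrite /nfst npairS lognM ?expn_gt0 // pfactorK //.
by rewrite (@logn_coprime 2 y.*2.+1) ?addn0 // coprime2n /= odd_double.
Qed.

Lemma npairK2 x y : nsnd (npair x y) = y.
Proof.
by rewrite /nsnd npairK1 npairS mulKn ?expn_gt0 //= uphalf_double.
Qed.

Lemma npair_surj n : npair (nfst n) (nsnd n) = n.
Proof.
rewrite /npair /nsnd /nfst; set e := logn 2 n.+1.
have /dvdnP[m def_n] : 2 ^ e %| n.+1 by rewrite pfactor_dvdn.
have m_gt0 : 0 < m by case: m def_n.
have m_odd : odd m.
  have : logn 2 n.+1 = logn 2 m + e by rewrite def_n lognM ?expn_gt0 // pfactorK.
  rewrite -/e => /eqP; rewrite -{1}[e]add0n eqn_add2r => /eqP /esym lm0.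
  rewrite -[odd m]negbK -dvdn2 -[2]expn1 pfactor_dvdn // lm0 //.
rewrite def_n mulnK ?expn_gt0 //.
by rewrite -[in RHS]/(n.+1.-1) def_n mulnC -[in RHS](odd_double_half m) m_odd.
Qed.

Lemma code_cons x s : CodeSeq.code (x :: s) = (npair x (CodeSeq.code s)).+1.
Proof. by rewrite npairS. Qed.

(* The total recursive functions, in the unary presentation with pairing;
   minimization is applied to regular functions only. *)
Inductive recursive : (nat -> nat) -> Prop :=
| recursive_zero : recursive (fun _ => 0)
| recursive_succ : recursive S
| recursive_fst : recursive nfst
| recursive_snd : recursive nsnd
| recursive_pair f g : recursive f -> recursive g ->
    recursive (fun n => npair (f n) (g n))
| recursive_comp f g : recursive f -> recursive g ->
    recursive (fun n => f (g n))
| recursive_prec f g : recursive f -> recursive g ->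
    recursive (fun n =>
      iteri (nsnd n) (fun y z => g (npair (nfst n) (npair y z))) (f (nfst n)))
| recursive_mu f h : recursive f ->
    (forall a, f (npair a (h a)) = 0 /\
               forall m, m < h a -> f (npair a m) <> 0) ->
    recursive h.

Definition word := seq nat.
Definition baire := nat -> nat.

Definition initial (w : word) (p : baire) : Prop := w = mkseq p (size w).

(* r, an infinite sequence, is the supremum of W in the prefix order. *)
Definition is_sup (W : set word) (r : baire) : Prop :=
  (forall w, W w -> initial w r) /\
  (forall n, exists2 w, W w & n <= size w).

Lemma is_sup_uniq W r s : is_sup W r -> is_sup W s -> r = s.
Proof.
move=> [Wr Wlen] [Ws _]; apply/funext => n.
have [w Ww ltn] := Wlen n.+1.
by rewrite -(nth_mkseq 0 r ltn) -(nth_mkseq 0 s ltn) -(Wr w Ww) -(Ws w Ww).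
Qed.

(* A partial multivalued function is given by its graph: f x is the set of
   values at x, and x is in the domain when this set is nonempty.  Partial
   functions are the single-valued ones. *)
Definition mvf (X Y : Type) := X -> set Y.
Definition mdom X Y (f : mvf X Y) : set X := [set x | f x !=set0].
Definition single_valued X Y (f : mvf X Y) :=
  forall x y z, f x y -> f x z -> y = z.

Definition mid X : mvf X X := fun x => [set x].
Definition mcomp X Y Z (g : mvf Y Z) (f : mvf X Y) : mvf X Z :=
  fun x => [set z | f x `<=` mdom g /\ exists2 y, f x y & g y z].
Definition minv X Y (f : mvf X Y) : mvf Y X := fun y => [set x | f x y].

Lemma mdom_comp X Y Z (g : mvf Y Z) (f : mvf X Y) :
  mdom (mcomp g f) = [set x | mdom f x /\ f x `<=` mdom g].
Proof.
apply/seteqP; split => [x [z [fg [y fxy _]]]|x [[y fxy] fg]].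
  by split=> //; exists y.
by have [z gyz] := fg _ fxy; exists z; split=> //; exists y.
Qed.

Definition computable_word (phi : word -> word) : Prop :=
  recursive (fun n => CodeSeq.code (phi (CodeSeq.decode n))).
Definition monotone_word (phi : word -> word) : Prop :=
  forall u v, prefix u v -> prefix (phi u) (phi v).

Definition computable (F : mvf baire baire) : Prop :=
  exists phi, [/\ monotone_word phi, computable_word phi &
    forall p r, F p r -> is_sup (phi @` [set w | initial w p]) r].

Lemma computable_single_valued F : computable F -> single_valued F.
Proof. by move=> [phi [_ _ h]] p r s /h hr /h /(is_sup_uniq hr). Qed.

Definition bpair (q p : baire) : baire :=
  fun n => if odd n then p n./2 else q n./2.

Definition tuple_of (p : nat -> baire) : baire := fun n => p (nfst n) (nsnd n).

Definition juxt (F G : mvf baire baire) : mvf baire baire :=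
  fun p => [set s | exists q r, [/\ F p q, G p r & s = bpair q r]].

Definition id_times (f : mvf baire baire) : mvf baire baire :=
  fun s => [set t | exists q p r, [/\ s = bpair q p, f p r & t = bpair q r]].

(* The digits 0, 1, 2 of a name q are dummies; a digit n.+3 encodes a pair
   (u, v) of words, and q lists the graph of a monotone word function.  Every
   q is a name: Phi q p is the supremum of the words v listed with some prefix
   u of p, and is undefined if these are incompatible or of bounded length. *)
Definition listed (q : baire) (u v : word) : Prop :=
  exists n, q n = (npair (CodeSeq.code u) (CodeSeq.code v)).+3.

Definition Phi (q : baire) : mvf baire baire :=
  fun p => [set r | is_sup [set v | exists2 u, initial u p & listed q u v] r].

Definition U : mvf baire baire :=
  fun s => [set r | exists q p, s = bpair q p /\ Phi q p r].

Lemma Phi_single_valued q : single_valued (Phi q).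
Proof. by move=> p r s; apply: is_sup_uniq. Qed.

Record repSpace := RepSpace {
  carrier :> Type;
  delta : mvf baire carrier;
  delta_single_valued : single_valued delta;
  delta_surjective : forall x, exists p, delta p x
}.

Lemma mid_single_valued X : single_valued (@mid X).
Proof. by move=> x y z -> ->. Qed.

Lemma mid_surjective X (x : X) : exists p, mid p x.
Proof. by exists x. Qed.

Definition baire_space : repSpace :=
  RepSpace (@mid_single_valued baire) (@mid_surjective baire).

Definition seq_delta (X : repSpace) : mvf baire (nat -> X) :=
  fun s => [set x | exists2 p, s = tuple_of p & forall i, delta (p i) (x i)].

Lemma tuple_of_inj : injective tuple_of.
Proof.
move=> p q /(congr1 (fun s n m => s (npair n m))) pq.
apply/funext => i; apply/funext => j.
move: (congr1 (fun s => s i j) pq).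
by rewrite /tuple_of npairK1 npairK2.
Qed.

Lemma seq_delta_single_valued X : single_valued (@seq_delta X).
Proof.
move=> s x y [p -> px] [q /tuple_of_inj <- qy].
by apply/funext => i; apply: delta_single_valued (px i) (qy i).
Qed.

Lemma seq_delta_surjective (X : repSpace) (x : nat -> X) :
  exists s, seq_delta s x.
Proof.
have [p px] := choice (fun i => delta_surjective (x i)).
by exists (tuple_of p), p.
Qed.

Definition seq_space (X : repSpace) : repSpace :=
  RepSpace (@seq_delta_single_valued X) (@seq_delta_surjective X).

Record problem := Problem {
  source : repSpace;
  target : repSpace;
  values :> mvf source target
}.
Arguments values : clear implicits.

Definition realizes (F : mvf baire baire) (f : problem) : Prop :=
  single_valued F /\
  forall p, mdom (mcomp f (@delta (source f))) p ->
    exists2 y, mcomp (@delta (target f)) F p y & mcomp f (@delta (source f)) p y.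

(* With values given by their graph, every multivalued function between
   represented spaces is a problem. *)
Lemma realizer_exists f : exists F, realizes F f.
Proof.
pose A p r := exists2 y, delta r y & mcomp f (@delta (source f)) p y.
exists (fun p => [set r | (exists r', A p r') /\ r = xget p (A p)]); split.
  by move=> p y z [_ ->] [_ ->].
move=> p [y fpy]; have [r ry] := delta_surjective y.
have Ap : exists r', A p r' by exists r, y.
have [y' hy' fy'] : A p (xget p (A p)) by case: Ap => r'; apply: xgetI.
exists y' => //; split; last by exists (xget p (A p)).
by move=> s [_ ->]; exists y'.
Qed.

Definition realizer_version (f : problem) : mvf baire baire :=
  mcomp (minv (@delta (target f))) (mcomp f (@delta (source f))).

Definition leW (f g : problem) : Prop :=
  exists H K, [/\ computable H, computable K &
    forall G, realizes G g ->
      realizes (mcomp H (juxt (@mid baire) (mcomp G K))) f].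

Definition lesW (f g : problem) : Prop :=
  exists H K, [/\ computable H, computable K &
    forall G, realizes G g -> realizes (mcomp H (mcomp G K)) f].

Definition equivsW (f g : problem) : Prop := lesW f g /\ lesW g f.

Definition L (f : mvf baire baire) : mvf baire baire := mcomp U (id_times f).

Fixpoint reach (f : mvf baire baire) (q0 : baire) (i : nat) : set baire :=
  if i is j.+1 then [set z | exists2 y, reach f q0 j y & L f y z]
  else [set q0].

Definition loop_dom (f : mvf baire baire) : set baire :=
  [set q0 | forall i, reach f q0 i `<=` mdom (L f)].

Definition loop (f : mvf baire baire) : mvf baire baire :=
  fun q0 => [set s | loop_dom f q0 /\
    exists q : nat -> baire,
      [/\ q 0 = q0, forall i, L f (q i) (q i.+1) & s = tuple_of q]].

(* Only the entries q 0, ..., q k matter in the next three definitions. *)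
Definition finite_run (f : mvf baire baire) (q : nat -> baire) (k : nat) :=
  forall i, i < k -> L f (q i) (q i.+1).

Definition successful (f : mvf baire baire) (q : nat -> baire) (k : nat) :=
  [/\ finite_run f q k, q k 0 = 0 & forall i, i < k -> q i 0 <> 0].

Definition stalls (f : mvf baire baire) (q : nat -> baire) (k : nat) :=
  [/\ finite_run f q k, ~ mdom (L f) (q k) & forall i, i <= k -> q i 0 <> 0].

Definition infinite_unsuccessful (f : mvf baire baire) (q : nat -> baire) :=
  (forall i, L f (q i) (q i.+1)) /\ (forall i, q i 0 <> 0).

Definition diamond_dom (f : mvf baire baire) : set baire :=
  [set q0 | forall q : nat -> baire, q 0 = q0 ->
    (forall k, ~ stalls f q k) /\ ~ infinite_unsuccessful f q].

Definition diamond (f : mvf baire baire) : mvf baire baire :=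
  fun q0 => [set r | diamond_dom f q0 /\
    exists (q : nat -> baire) k, [/\ q 0 = q0, successful f q k & r = q k]].

Fixpoint iterate (f : mvf baire baire) (n : nat) : mvf baire baire :=
  match n with
  | 0 => @mid baire
  | 1 => id_times f
  | m.+1 => mcomp (id_times f) (mcomp U (iterate f m))
  end.

Definition omega (f : mvf baire baire) : mvf baire baire :=
  fun p => [set s | exists2 r : nat -> baire,
    forall n, iterate f n p (r n) & s = tuple_of r].

(* The explicitly prescribed domains are the sets of points with values. *)
Lemma mdom_loop f : mdom (loop f) = loop_dom f.
Proof.
apply/seteqP; split=> [q0 [s []] //|q0 dq0].
have /choice[next nextP] (y : baire) : exists z, mdom (L f) y -> L f y z.
  by have [[z yz]|ny] := pselect (mdom (L f) y); [exists z | exists y].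
pose q := fun i => iter i next q0.
have qr i : reach f q0 i (q i).
  elim: i => [//|i IH]; exists (q i) => //; exact: nextP (dq0 _ _ IH).
exists (tuple_of q); split=> //; exists q; split=> // i.
exact: nextP (dq0 _ _ (qr i)).
Qed.

Lemma mdom_diamond f : mdom (diamond f) = diamond_dom f.
Proof.
apply/seteqP; split=> [q0 [s []] //|q0 dq0].
have /choice[next nextP] (y : baire) : exists z, mdom (L f) y -> L f y z.
  by have [[z yz]|ny] := pselect (mdom (L f) y); [exists z | exists y].
pose q := fun i => iter i next q0.
have [nstall ninf] := dq0 q erefl.
have run k : (forall i, i < k -> q i 0 <> 0) -> finite_run f q k.
  elim: k => [//|k IH] nz i; rewrite ltnS leq_eqVlt => /predU1P[->|]; last first.
    by apply: IH => j jk; apply: nz; apply: ltnW.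
  apply: nextP; apply: contrapT => nd; apply: (nstall k); split=> //.
  by apply: IH => j jk; apply: nz; apply: ltnW.
have [[k qk0]|nk] := pselect (exists k, q k 0 == 0).
  have ex : exists k, q k 0 == 0 by exists k.
  case: (ex_minnP ex) => m /eqP qm0 mmin.
  have nz i : i < m -> q i 0 <> 0.
    by move=> im qi0; have := mmin i; rewrite qi0 eqxx leqNgt im => /(_ isT).
  exists (q m); split=> //; exists q, m; split=> //; split=> //; exact: run.
have nz i : q i 0 <> 0 by move=> qi0; apply: nk; exists i; rewrite qi0.
by case: ninf; split=> // i; apply: (run i.+1).
Qed.

Lemma mdom_omega f :
  mdom (omega f) = [set p | forall n, mdom (iterate f n) p].
Proof.
apply/seteqP; split=> [p [s [r rP _]] n|p /choice[r rP]].
  by exists (r n).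
by exists (tuple_of r), r.
Qed.

Definition on_baire (F : mvf baire baire) : problem :=
  @Problem baire_space baire_space F.

Definition infinite_loop (f : problem) : problem :=
  on_baire (loop (realizer_version f)).
Definition diamond_problem (f : problem) : problem :=
  on_baire (diamond (realizer_version f)).
Definition omega_problem (f : problem) : problem :=
  on_baire (omega (realizer_version f)).

Definition parallelization (f : problem) : problem :=
  @Problem (seq_space (source f)) (seq_space (target f))
    (fun x => [set y | forall i, values f (x i) (y i)]).

(* Turing reducibility as computability of q from the oracle p by a computable
   partial function on Baire space. *)
Definition turing_le (q p : baire) : Prop :=
  exists2 F, computable F & F p q.
Definition turing_lt (q p : baire) : Prop := turing_le q p /\ ~ turing_le p q.

Definition turing_class (p : baire) : set baire :=
  [set q | turing_le q p /\ turing_le p q].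

Definition degree : Type := {A : set baire | exists p, A = turing_class p}.
Definition deg (p : baire) : degree :=
  exist _ (turing_class p) (ex_intro _ p erefl).

Definition degree_delta : mvf baire degree := fun p => [set deg p].

Lemma degree_delta_single_valued : single_valued degree_delta.
Proof. by move=> p a b -> ->. Qed.

Lemma degree_delta_surjective (a : degree) : exists p, degree_delta p a.
Proof. by case: a => A [p defA]; exists p; apply: eq_exist. Qed.

Definition degree_space : repSpace :=
  RepSpace degree_delta_single_valued degree_delta_surjective.

(* The computable sequences form a single degree, that of any one of them. *)
Definition zero_degree : degree := deg (fun _ => 0).

Definition descending (p : nat -> baire) : Prop :=
  (forall n, turing_lt (p n.+1) (p n)) /\
  turing_lt (tuple_of (fun n => p n.+1)) (p 0).

(* For a = (a_0, a_1, ...) pairwise distinct and nonzero, the three clauses are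
   mutually exclusive and the domain is {0} together with the a_n. *)
Definition climb (a : nat -> degree) : problem :=
  @Problem degree_space degree_space (fun x =>
    [set y | [\/ x = a 0 /\ y = a 0,
                 exists2 n, x = a n.+1 & y = a n |
                 x = zero_degree /\ exists n, y = a n]]).

(* Main.v *)
From mathcomp Require Import all_boot.
From mathcomp Require Import boolp classical_sets.
Require Import Defs.

(* For F = f^r, a value of F at a computable point is any sequence of some degree
   a_n, and every further query climbs one step, so that the infinite loop
   computes p_0.  A run of length n, in contrast, can be answered by sequences
   below a_1, whose finite prefixes are arbitrary; a forcing argument therefore
   finds a value of f^omega that does not compute p_0, which gives the
   non-reducibility.

   f^omega is below the parallelization of f^diamond for every f: the n-th
   instance of f^diamond carries a countdown from n.  The converse uses that F is
   closed under finite modifications of its values: a successful run is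
   already determined by finite words, which can be searched for and then
   imposed on the true answers.  The number of steps needed for each instance is
   therefore known in advance, and all instances are run one after the other by
   a single program, whose n-th state is a component of f^omega. *)

Set Implicit Arguments.
Unset Strict Implicit.
Unset Printing Implicit Defensive.

Local Open Scope classical_set_scope.

(** * Recursive functions on coded types *)

(** A component of a value of f^omega shows a program together with an answer that this program has
    not yet processed, and the answer is beyond control. Whatever a reduction wants to read off
    later must therefore be stored in the program. This is why the programs are self-reproducing
    machines, obtained from a recursion theorem, whose names carry their state as harmless digits.
    For f^diamond the difficulty is that the length of a run depends on the answers. Finite scripts
    fix the lengths, so the positions of the results in f^omega can be computed from the scripts
    alone, and the outer functional needs no access to the input. For the non-reducibility, each
    single component of f^omega can be kept below p_1, but infinitely many components chosen in this
    way might jointly compute p_0, because the choices for different lengths are not uniform. Hence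
    the forcing acts on all lengths at once. A reduction must work with every realizer, so one bad
    value at one computable point refutes it. *)

Class coded (T : Type) := enc : T -> nat.
#[local] Instance coded_nat : coded nat := id.
#[local] Instance coded_bool : coded bool := nat_of_bool.
#[local] Instance coded_word : coded word := CodeSeq.code.
#[local] Instance coded_prod A B (_ : coded A) (_ : coded B) : coded (A * B) :=
  fun x => npair (enc x.1) (enc x.2).
#[local] Hint Extern 0 (coded (seq nat)) => exact coded_word : typeclass_instances.

Definition rec A B {cA : coded A} {cB : coded B} (f : A -> B) : Prop :=
  exists2 g, recursive g & forall a, g (enc a) = enc (f a).
Definition rec2 A B C {cA : coded A} {cB : coded B} {cC : coded C}
  (f : A -> B -> C) : Prop := rec (fun x => f x.1 x.2).

Lemma recursive_id : recursive (fun n => n).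
Proof.
have -> : (fun n => n) = (fun n => npair (nfst n) (nsnd n)).
  by apply/funext => n; rewrite npair_surj.
exact: recursive_pair recursive_fst recursive_snd.
Qed.

Lemma recursive_const k : recursive (fun _ => k).
Proof.
elim: k => [|k IH]; first exact: recursive_zero.
exact: recursive_comp recursive_succ IH.
Qed.

Lemma recursive_ext f g : recursive f -> f =1 g -> recursive g.
Proof. by move=> rf /funext <-. Qed.

(** Case distinction is a primitive recursion over [c n] with parameter [npair (a n) (b n)]: it
    starts from [a n], and every step returns [b n], whatever the counter and the previous value. *)
Lemma recursive_if0 c a b : recursive c -> recursive a -> recursive b ->
  recursive (fun n => if c n == 0 then a n else b n).
Proof.
move=> rc ra rb.
have r := recursive_prec recursive_fst (recursive_comp recursive_snd recursive_fst).
apply: recursive_ext (recursive_comp r (recursive_pair (recursive_pair ra rb) rc)) _.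
by move=> n; rewrite !(npairK1, npairK2); case: (c n) => [|k] //=;
  rewrite ?(npairK1, npairK2).
Qed.

Lemma rec_id A {_ : coded A} : rec (fun x : A => x).
Proof. by exists id => //; exact: recursive_id. Qed.

Lemma rec_const A B {_ : coded A} {_ : coded B} (b : B) : rec (fun _ : A => b).
Proof. by exists (fun _ => enc b) => //; exact: recursive_const. Qed.

Lemma rec_comp A B C {_ : coded A} {_ : coded B} {_ : coded C}
  (f : B -> C) (g : A -> B) : rec f -> rec g -> rec (fun x => f (g x)).
Proof.
move=> [f' rf hf] [g' rg hg]; exists (fun n => f' (g' n)).
  exact: recursive_comp.
by move=> a; rewrite hg hf.
Qed.

Lemma rec_pair A B C {_ : coded A} {_ : coded B} {_ : coded C}
  (f : A -> B) (g : A -> C) : rec f -> rec g -> rec (fun x => (f x, g x)).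
Proof.
move=> [f' rf hf] [g' rg hg]; exists (fun n => npair (f' n) (g' n)).
  exact: recursive_pair.
by move=> a; rewrite hg hf.
Qed.

Lemma rec_app2 A B C D {cA : coded A} {cB : coded B} {cC : coded C} {cD : coded D}
  (op : B -> C -> D) (f : A -> B) (g : A -> C) :
  rec2 op -> rec f -> rec g -> rec (fun x => op (f x) (g x)).
Proof. by move=> rop rf rg; exact: rec_comp rop (rec_pair rf rg). Qed.

Lemma rec_fst A B {_ : coded A} {_ : coded B} : rec (@fst A B).
Proof.
by exists nfst => [|[a b]]; [exact: recursive_fst | rewrite /enc/= npairK1].
Qed.

Lemma rec_snd A B {_ : coded A} {_ : coded B} : rec (@snd A B).
Proof.
by exists nsnd => [|[a b]]; [exact: recursive_snd | rewrite /enc/= npairK2].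
Qed.

Lemma rec_if A B {_ : coded A} {_ : coded B} (c : A -> bool) (f g : A -> B) :
  rec c -> rec f -> rec g -> rec (fun x => if c x then f x else g x).
Proof.
move=> [c' rc hc] [f' rf hf] [g' rg hg].
exists (fun n => if c' n == 0 then g' n else f' n); first exact: recursive_if0.
by move=> a; rewrite hc hf hg; case: (c a).
Qed.

Lemma rec_iteri A B {_ : coded A} {_ : coded B}
  (n : A -> nat) (g : A -> nat -> B -> B) (f : A -> B) :
  rec n -> rec (fun x : A * (nat * B) => g x.1 x.2.1 x.2.2) -> rec f ->
  rec (fun x => iteri (n x) (g x) (f x)).
Proof.
move=> [n' rn hn] [g' rg hg] [f' rf hf].
exists (fun k => iteri (n' k) (fun y z => g' (npair k (npair y z))) (f' k)).
  apply: recursive_ext (recursive_comp (recursive_prec rf rg)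
    (recursive_pair recursive_id rn)) _.
  by move=> k; rewrite npairK1 npairK2.
move=> a; rewrite hn hf /enc /=; elim: (n a) => //= k ->.
exact: (hg (a, (k, _))).
Qed.

Create HintDb rec.
#[local] Hint Resolve rec_fst rec_snd : rec.

Lemma rec_S : rec S.
Proof. by exists S => //; exact: recursive_succ. Qed.
Lemma rec_nfst : rec nfst.
Proof. by exists nfst => //; exact: recursive_fst. Qed.
Lemma rec_nsnd : rec nsnd.
Proof. by exists nsnd => //; exact: recursive_snd. Qed.
Lemma rec_npair : rec2 npair.
Proof. by exists id => //; exact: recursive_id. Qed.
Lemma rec_pair2 A B {_ : coded A} {_ : coded B} : rec2 (@pair A B).
Proof. by exists id => [|[]//]; exact: recursive_id. Qed.
#[local] Hint Resolve rec_S rec_nfst rec_nsnd rec_npair rec_pair2 : rec.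

(** The head of the body selects the closure lemma. An operation not registered as a binary
    recursive one is tried again as a unary function with its first argument frozen; whatever is
    left must be a conditional. *)
Ltac rec_step :=
  cbv beta;
  lazymatch goal with
  | |- rec (fun c => c) => exact: rec_id
  | |- rec (fun _ => ?k) => exact: rec_const
  | |- rec (fun c => iteri (@?n c) (@?g c) (@?f c)) =>
      refine (@rec_iteri _ _ _ _ n g f _ _ _)
  | |- rec (fun c => ?op (@?f c) (@?g c)) =>
      (refine (@rec_app2 _ _ _ _ _ _ _ _ op f g _ _ _); [solve [auto with rec] | |]) ||
      (refine (@rec_comp _ _ _ _ _ _ (op _) g _ _); [solve [auto with rec] |])
  | |- rec (fun c => ?op (@?f c)) =>
      refine (@rec_comp _ _ _ _ _ _ op f _ _); [solve [auto with rec] |]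
  | |- rec (fun c => _) => refine (@rec_if _ _ _ _ _ _ _ _ _ _)
  | |- _ => solve [auto with rec]
  end.
Ltac rec_tac := repeat rec_step.

Lemma rec_ext A B {_ : coded A} {_ : coded B} (f g : A -> B) :
  rec f -> f =1 g -> rec g.
Proof. by move=> rf /funext <-. Qed.

Lemma rec_pred : rec predn.
Proof.
have : rec (fun n : nat => iteri n (fun y _ => y) 0) by rec_tac.
by move/rec_ext; apply; case.
Qed.
Lemma rec_add : rec2 addn.
Proof.
have : rec (fun x : nat * nat => iteri x.2 (fun _ z => z.+1) x.1) by rec_tac.
by move/rec_ext; apply => -[a b] /=; elim: b => [|b /= ->]; rewrite ?addn0 ?addnS.
Qed.
#[local] Hint Resolve rec_pred rec_add : rec.
Lemma rec_sub : rec2 subn.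
Proof.
have : rec (fun x : nat * nat => iteri x.2 (fun _ z => z.-1) x.1) by rec_tac.
by move/rec_ext; apply => -[a b] /=; elim: b => [|b /= ->]; rewrite ?subn0 ?subnS.
Qed.
Lemma rec_negb : rec negb.
Proof.
have : rec (fun x : bool => if x then false else true) by rec_tac.
by move/rec_ext; apply => -[].
Qed.
Lemma rec_andb : rec2 andb.
Proof.
have : rec (fun x : bool * bool => if x.1 then x.2 else false) by rec_tac.
by move/rec_ext; apply => -[[]].
Qed.
#[local] Hint Resolve rec_sub rec_negb rec_andb : rec.
Lemma rec_odd : rec odd.
Proof.
have : rec (fun n : nat => iteri n (fun _ b => ~~ b) false) by rec_tac.
by move/rec_ext; apply; elim=> //= n ->.
Qed.
#[local] Hint Resolve rec_odd : rec.
Lemma rec_half : rec half.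
Proof.
have : rec (fun n : nat => iteri n (fun y z => if odd y then z.+1 else z) 0) by rec_tac.
move/rec_ext; apply; elim=> //= n ->; rewrite uphalf_half.
by case: (odd n).
Qed.
Lemma rec_double : rec double.
Proof.
have : rec (fun n : nat => n + n) by rec_tac.
by move/rec_ext; apply => n; rewrite addnn.
Qed.
#[local] Hint Resolve rec_half rec_double : rec.
Lemma rec_leq : rec2 leq.
Proof.
have h : rec (fun n : nat => iteri n (fun _ _ => false) true) by rec_tac.
have : rec (fun x : nat * nat => iteri (x.1 - x.2) (fun _ _ => false) true) by rec_tac.
by move/rec_ext; apply => -[a b] /=; rewrite /leq; case: (a - b).
Qed.
#[local] Hint Resolve rec_leq : rec.
Lemma rec_eqn : rec2 (@eq_op nat).
Proof.
have : rec (fun x : nat * nat => (x.1 <= x.2) && (x.2 <= x.1)) by rec_tac.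
by move/rec_ext; apply => -[a b] /=; rewrite -eqn_leq.
Qed.
#[local] Hint Resolve rec_eqn : rec.
Lemma rec_minn : rec2 minn.
Proof.
have : rec (fun x : nat * nat => if x.1.+1 <= x.2 then x.1 else x.2) by rec_tac.
by move/rec_ext; apply.
Qed.
Lemma rec_cons : rec2 (@cons nat).
Proof.
have : rec (fun x : nat * nat => (npair x.1 x.2).+1) by rec_tac.
case=> g rg hg; exists g => // -[a s].
by rewrite /enc /coded_word code_cons; exact: hg (a, CodeSeq.code s).
Qed.
Lemma rec_code : rec CodeSeq.code.
Proof. by exists id => //; exact: recursive_id. Qed.
Lemma rec_decode : rec CodeSeq.decode.
Proof.
exists id => [|n]; first exact: recursive_id.
by rewrite /enc /coded_word CodeSeq.decodeK.
Qed.
Lemma rec_head : rec (@head nat 0).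
Proof.
exists (fun n => nfst n.-1) => [|[|x s]].
- have [g rg hg] : rec (fun n : nat => nfst n.-1) by rec_tac.
  exact: recursive_ext rg hg.
- by [].
- by rewrite /enc /coded_word code_cons npairK1.
Qed.
Lemma rec_behead : rec (@behead nat).
Proof.
exists (fun n => nsnd n.-1) => [|[|x s]].
- have [g rg hg] : rec (fun n : nat => nsnd n.-1) by rec_tac.
  exact: recursive_ext rg hg.
- by [].
- by rewrite /enc /coded_word code_cons npairK2.
Qed.
#[local] Hint Resolve rec_minn rec_cons rec_code rec_decode rec_head rec_behead : rec.

Lemma rec_eqw : rec2 (@eq_op word).
Proof.
have : rec (fun x : word * word => CodeSeq.code x.1 == CodeSeq.code x.2) by rec_tac.
move/rec_ext; apply => -[a b] /=.
by rewrite (inj_eq (can_inj CodeSeq.codeK)).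
Qed.
Lemma rec_drop : rec2 (@drop nat).
Proof.
have : rec (fun x : nat * word => iteri x.1 (fun _ z => behead z) x.2) by rec_tac.
move/rec_ext; apply => -[n s] /=; elim: n => [|n /= ->]; first by rewrite drop0.
by rewrite -drop1 drop_drop.
Qed.
#[local] Hint Resolve rec_eqw rec_drop : rec.
Lemma rec_nth : rec2 (@nth nat 0).
Proof.
have : rec (fun x : word * nat => head 0 (drop x.2 x.1)) by rec_tac.
by move/rec_ext; apply => -[s n] /=; rewrite -nth0 nth_drop addn0.
Qed.
#[local] Hint Resolve rec_nth : rec.

Lemma leq_npair2 x y : y <= npair x y.
Proof.
rewrite -ltnS npairS; apply: (@leq_trans y.*2.+1).
  by rewrite ltnS -addnn leq_addr.
by rewrite leq_pmull // expn_gt0.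
Qed.
Lemma leq_npair1 x y : x <= npair x y.
Proof.
rewrite -ltnS npairS; apply: leq_trans (ltn_expl x (isT : 1 < 2)) _.
by rewrite leq_pmulr.
Qed.
Lemma npair_mono x y z : y <= z -> npair x y <= npair x z.
Proof.
by move=> yz; rewrite -ltnS !npairS leq_pmul2l ?expn_gt0 // ltnS leq_double.
Qed.

Lemma size_code (s : word) : size s <= CodeSeq.code s.
Proof.
by elim: s => // x s IH; rewrite code_cons ltnS (leq_trans IH) ?leq_npair2.
Qed.

(** The recursion runs over numbers. The code of a word bounds its length, so the length is the
    number of [i] below the code at which [drop i s] is nonempty. *)
Lemma rec_size : rec (@size nat).
Proof.
have : rec (fun s : word => iteri (CodeSeq.code s)
   (fun i z => if drop i s == [::] then z else z.+1) 0) by rec_tac.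
move/rec_ext; apply => s; rewrite -(minn_idPr (size_code s)).
elim: (CodeSeq.code s) => [|k /= ->]; first by rewrite min0n.
rewrite -size_eq0 size_drop subn_eq0.
by case: (leqP (size s) k) => h;
  [rewrite !(minn_idPr _) // ltnW | rewrite !(minn_idPl _) // ltnW].
Qed.
#[local] Hint Resolve rec_size : rec.

Lemma rec_mkseq A {_ : coded A} (F : A -> nat -> nat) (n : A -> nat) :
  rec n -> rec2 F -> rec (fun x => mkseq (F x) (n x)).
Proof.
move=> rn rF.
have : rec (fun x => iteri (n x) (fun i s => F x (n x - i.+1) :: s) [::]).
  by rec_tac.
move/rec_ext; apply => x.
have h k : k <= n x -> iteri k (fun i s => F x (n x - i.+1) :: s) [::] =
     [seq F x i | i <- iota (n x - k) k].
  elim: k => //= k IH kn; rewrite IH; last exact: ltnW.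
  by rewrite subnS prednK // subn_gt0.
by rewrite h // subnn.
Qed.

(** The word is read from its end: [find] on a suffix determines [find] on the suffix that is longer
    by one letter. *)
Lemma rec_find A {_ : coded A} (P : A -> nat -> bool) (s : A -> word) :
  rec s -> rec2 P -> rec (fun x => find (P x) (s x)).
Proof.
move=> rs rP.
have : rec (fun x => iteri (size (s x)) (fun i z =>
   if P x (nth 0 (s x) (size (s x) - i.+1)) then 0 else z.+1) 0).
  by rec_tac.
move/rec_ext; apply => x; move: (s x) => t.
have h k : k <= size t -> iteri k (fun i z =>
   if P x (nth 0 t (size t - i.+1)) then 0 else z.+1) 0 = find (P x) (drop (size t - k)
     t).
  elim: k => [|k IH] kn; first by rewrite subn0 drop_size.
  rewrite /= IH; last exact: ltnW.
  have lt : size t - k.+1 < size t by rewrite ltn_subrL (leq_trans _ kn).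
  by rewrite (drop_nth 0 lt) /= subnSK.
by rewrite h // subnn drop0.
Qed.

Ltac rec_step ::=
  cbv beta;
  lazymatch goal with
  | |- rec (fun c => c) => exact: rec_id
  | |- rec (fun _ => ?k) => exact: rec_const
  | |- rec (fun c => iteri (@?n c) (@?g c) (@?f c)) =>
      refine (@rec_iteri _ _ _ _ n g f _ _ _)
  | |- rec (fun c => mkseq (@?f c) (@?n c)) =>
      refine (@rec_mkseq _ _ f n _ _); rewrite ?/rec2
  | |- rec (fun c => find (@?P c) (@?s c)) =>
      refine (@rec_find _ _ P s _ _); rewrite ?/rec2
  | |- rec (fun c => ?op (@?f c) (@?g c)) =>
      (refine (@rec_app2 _ _ _ _ _ _ _ _ op f g _ _ _); [solve [auto with rec] | |]) ||
      (refine (@rec_comp _ _ _ _ _ _ (op _) g _ _); [solve [auto with rec] |])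
  | |- rec (fun c => ?op (@?f c)) =>
      refine (@rec_comp _ _ _ _ _ _ op f _ _); [solve [auto with rec] |]
  | |- rec (fun c => _) => refine (@rec_if _ _ _ _ _ _ _ _ _ _)
  | |- _ => solve [auto with rec]
  end.

Lemma rec_cat : rec2 (@cat nat).
Proof.
have : rec (fun x : word * word => mkseq (fun i => if i.+1 <= size x.1 then nth 0 x.1 i
   else nth 0 x.2 (i - size x.1)) (size x.1 + size x.2)) by rec_tac.
move/rec_ext; apply => -[s t] /=.
apply: (@eq_from_nth _ 0); first by rewrite size_mkseq size_cat.
by move=> i; rewrite size_mkseq => h; rewrite nth_mkseq // nth_cat.
Qed.
Lemma rec_take : rec2 (@take nat).
Proof.
have : rec (fun x : nat * word => mkseq (nth 0 x.2) (minn x.1 (size x.2))) by rec_tac.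
move/rec_ext; apply => -[n s] /=.
apply: (@eq_from_nth _ 0); first by rewrite size_mkseq size_take_min.
move=> i; rewrite size_mkseq => h; rewrite nth_mkseq // nth_take //.
by apply: leq_trans h _; rewrite geq_minl.
Qed.
#[local] Hint Resolve rec_cat rec_take : rec.
Lemma rec_prefix : rec2 (@prefix nat).
Proof.
have : rec (fun x : word * word => take (size x.1) x.2 == x.1) by rec_tac.
by move/rec_ext; apply => -[s t] /=; rewrite prefixE.
Qed.
#[local] Hint Resolve rec_prefix : rec.

(** [computable_word] constrains all numbers, [rec] only the codes; the two agree because every
    number is the code of a word. *)
Lemma rec_computable_word phi : rec phi -> computable_word phi.
Proof.
move=> [g rg hg]; apply: recursive_ext rg _ => n.
by rewrite -[n in LHS]CodeSeq.decodeK; exact: hg.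
Qed.

Lemma computable_word_rec phi : computable_word phi -> rec phi.
Proof. by move=> h; eexists; first exact: h; move=> a; rewrite /= CodeSeq.codeK. Qed.

(** * Computable functions on Baire space *)

Lemma initialP w p : initial w p <-> forall i, i < size w -> nth 0 w i = p i.
Proof.
split=> [-> i|h]; first by rewrite size_mkseq => h; rewrite nth_mkseq.
apply: (@eq_from_nth _ 0) => [|i hi]; first by rewrite size_mkseq.
by rewrite nth_mkseq // h.
Qed.

Lemma initial_mkseq p n : initial (mkseq p n) p.
Proof. by rewrite /initial size_mkseq. Qed.

Lemma take_mkseq (p : baire) m n : m <= n -> take m (mkseq p n) = mkseq p m.
Proof. by move=> mn; rewrite /mkseq -map_take take_iota (minn_idPl mn). Qed.

Lemma prefix_mkseq (p : baire) m n : m <= n -> prefix (mkseq p m) (mkseq p n).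
Proof. by move=> mn; rewrite prefixE size_mkseq take_mkseq. Qed.

Lemma initial_prefix u v p : initial u p -> initial v p -> size u <= size v ->
  prefix u v.
Proof. by move=> -> ->; rewrite !size_mkseq => h; apply: prefix_mkseq. Qed.

Lemma prefix_initial u v p : prefix u v -> initial v p -> initial u p.
Proof.
move=> uv iv; rewrite /initial; have := uv; rewrite prefixE iv.
by rewrite take_mkseq ?size_prefix_leq// => [/eqP//|]; exact: size_prefix.
Qed.

Definition approximates (g : word -> word) (p r : baire) : Prop :=
  (forall m, initial (g (mkseq p m)) r) /\
  (forall n, exists m, n <= size (g (mkseq p m))).

Lemma is_sup_approximates g p r :
  is_sup (g @` [set w | initial w p]) r <-> approximates g p r.
Proof.
split=> [] [h1 h2]; split.
- by move=> m; apply: h1; exists (mkseq p m) => //; exact: initial_mkseq.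
- by move=> n; have [_ [w -> <-]] := h2 n; exists (size w).
- by move=> _ [w -> <-].
- move=> n; have [m hm] := h2 n.
  by exists (g (mkseq p m)) => //; exists (mkseq p m) => //; exact: initial_mkseq.
Qed.

(* Replaces g by a monotone function that has the same suprema along the
   points where the values of g converge. *)
Definition monotonize (g : word -> word) (w : word) : word :=
  iteri (size w).+1
    (fun i o => if prefix o (g (take i w)) then g (take i w) else o) [::].

Lemma monotonize_monotone g : monotone_word (monotonize g).
Proof.
move=> u v uv; rewrite /monotonize.
have -> : (size v).+1 = (size v - size u) + (size u).+1.
  by rewrite addnS subnK // size_prefix.
elim: (size v - size u) => [|k IH].
  rewrite add0n.
  have h k : k <= (size u).+1 -> iteri k
     (fun i o => if prefix o (g (take i u)) then g (take i u) else o) [::] =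
     iteri k (fun i o => if prefix o (g (take i v)) then g (take i v) else o) [::].
    elim: k => // k IH ku; rewrite /= IH ?(ltnW ku) //.
    suff -> : take k u = take k v by [].
    by move: uv; rewrite prefixE => /eqP <-; rewrite take_takel.
  by rewrite h ?prefix_refl.
apply: prefix_trans IH _; rewrite addSn [X in prefix _ X]/=.
by case: ifP => // _; exact: prefix_refl.
Qed.

Lemma monotonize_approximates g p r :
  approximates g p r -> approximates (monotonize g) p r.
Proof.
move=> [gi gs].
have h m k : k <= m.+1 -> let o := iteri k (fun i o =>
  if prefix o (g (take i (mkseq p m)))
    then g (take i (mkseq p m)) else o) [::] in
    initial o r /\ forall i, i < k -> size (g (mkseq p i)) <= size o.
  elim: k => [//|k IH] km /=; rewrite take_mkseq //.
  have /= [io so] := IH (ltnW km); set o := iteri _ _ _ in io so *.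
  (* Both words are prefixes of [r], hence comparable. If [o] is not a prefix of the new value, then
     the new value is shorter and may be skipped. *)
  case: ifP => [|/negP] pre; split=> //.
  - move=> i; rewrite ltnS leq_eqVlt => /predU1P[->//|/so].
    by move/leq_trans; apply; exact: size_prefix.
  - move=> i; rewrite ltnS leq_eqVlt => /predU1P[->|/so//].
    rewrite leqNgt; apply/negP => hlt; apply: pre.
    by apply: initial_prefix io (gi _) _; exact: ltnW.
split=> [m|n]; first by have [] := h m m.+1 (leqnn _); rewrite /monotonize size_mkseq.
have [m hm] := gs n; exists m; have [_ /(_ m (ltnSn m))] := h m m.+1 (leqnn _).
by rewrite /monotonize size_mkseq; apply: leq_trans.
Qed.

(** [monotonize] supplies the missing monotonicity, so a recursive [g] with the right suprema is
    enough. *)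
Lemma computableI F g : rec g -> (forall p r, F p r -> approximates g p r) ->
  computable F.
Proof.
move=> rg h; exists (monotonize g); split.
- exact: monotonize_monotone.
- apply: rec_computable_word; rewrite /monotonize; rec_tac.
- by move=> p r /h /monotonize_approximates /is_sup_approximates.
Qed.

Lemma computableE F : computable F -> exists phi,
  [/\ monotone_word phi, rec phi & forall p r, F p r -> approximates phi p r].
Proof.
move=> [phi [m c h]]; exists phi; split=> //; first exact: computable_word_rec.
by move=> p r /h /is_sup_approximates.
Qed.

Lemma approximates_large phi p r : monotone_word phi -> approximates phi p r ->
  forall n, exists m0, forall m, m0 <= m -> n <= size (phi (mkseq p m)).
Proof.
move=> mp [_ h] n; have [m0 h0] := h n; exists m0 => m mm.
by apply: leq_trans h0 _; apply: size_prefix; apply: mp; exact: prefix_mkseq.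
Qed.

Lemma computable_sub (F G : mvf baire baire) : computable F ->
  (forall p r, G p r -> F p r) -> computable G.
Proof. by move=> [phi [m c h]] GF; exists phi; split=> // p r /GF /h. Qed.

Lemma computable_comp (G F : mvf baire baire) : computable F -> computable G ->
  computable (fun p => [set r | exists2 q, F p q & G q r]).
Proof.
move=> /computableE[phi [mphi rphi hphi]] /computableE[psi [mpsi rpsi hpsi]].
apply: (computableI (g := fun w => psi (phi w))); first by rec_tac.
move=> p r [q /hphi [phi1 phi2] /hpsi hq]; have [psi1 _] := hq; split=> [m|n].
  by rewrite (phi1 m); exact: psi1.
have [m0 /(_ _ (leqnn _)) h0] := approximates_large mpsi hq n.
have [m hm] := phi2 m0; exists m; apply: leq_trans h0 _.
by apply: size_prefix; apply: mpsi; rewrite (phi1 m); exact: prefix_mkseq.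
Qed.

(* d w n tells whether the n-th output digit is already known from the input
   prefix w; this digit is then g w n. *)
Definition collect (d : word -> nat -> bool) (g : word -> nat -> nat) (w : word) : word :=
  mkseq (g w) (find (fun n => ~~ d w n) (mkseq id (size w))).

Lemma collect_approximates (d : word -> nat -> bool) g p r :
  (forall m n, d (mkseq p m) n -> g (mkseq p m) n = r n) ->
  (forall n, exists m0, forall m, m0 <= m -> d (mkseq p m) n) ->
  approximates (collect d g) p r.
Proof.
move=> hg hd; split=> [m|n].
  apply/initialP => i; rewrite /collect size_mkseq => hi.
  rewrite nth_mkseq //; apply: hg.
  have /negbFE := before_find 0 hi; rewrite nth_mkseq => [//|].
  by apply: leq_trans hi _; rewrite -[leqRHS](size_mkseq id) find_size.
have [m0 hm0] : exists m0, forall m, m0 <= m -> forall i, i < n -> d (mkseq p m) i.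
  elim: n => [|n [m0 IH]]; first by exists 0.
  have [m1 h1] := hd n; exists (maxn m0 m1) => m; rewrite geq_max => /andP[a b] i.
  by rewrite ltnS leq_eqVlt => /predU1P[->|]; [exact: h1 | exact: IH].
exists (maxn m0 n); set m := maxn _ _; rewrite /collect size_mkseq leqNgt;
  apply/negP => lt.
have nm : n <= m by rewrite leq_maxr.
set w := mkseq p m in lt *; have sw : size w = m by rewrite size_mkseq.
have hf : find (fun n0 => ~~ d w n0) (mkseq id (size w)) < size (mkseq id (size w)).
  by rewrite size_mkseq; apply: leq_trans lt _; rewrite sw.
have := nth_find 0 (s := mkseq id (size w)) (a := fun n0 => ~~ d w n0).
rewrite has_find hf => /(_ isT); rewrite nth_mkseq.
  by move/negP; apply; apply: hm0 => //; exact: leq_maxl.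
by rewrite size_mkseq in hf.
Qed.

Lemma computable_digits (F : mvf baire baire) (d : word -> nat -> bool)
  (g : word -> nat -> nat) : rec2 d -> rec2 g ->
  (forall p r, F p r ->
    (forall m n, d (mkseq p m) n -> g (mkseq p m) n = r n) /\
    (forall n, exists m0, forall m, m0 <= m -> d (mkseq p m) n)) ->
  computable F.
Proof.
move=> rd rg h; apply: (computableI (g := collect d g)).
  by rewrite /collect; rec_tac.
by move=> p r /h[h1 h2]; exact: collect_approximates.
Qed.

Definition evens (s : baire) : baire := fun n => s n.*2.
Definition odds (s : baire) : baire := fun n => s n.*2.+1.
Definition col (s : baire) (i : nat) : baire := fun j => s (npair i j).
Definition scons (k : nat) (s : baire) : baire :=
  fun n => if n == 0 then k else s n.-1.
Definition stl (s : baire) : baire := fun n => s n.+1.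

Lemma evens_bpair p q : evens (bpair p q) = p.
Proof. by apply/funext => n; rewrite /evens /bpair odd_double doubleK. Qed.
Lemma odds_bpair p q : odds (bpair p q) = q.
Proof. by apply/funext => n; rewrite /odds /bpair /= odd_double /= uphalf_double. Qed.
Lemma bpairE s : bpair (evens s) (odds s) = s.
Proof.
apply/funext => n; rewrite /bpair /evens /odds -[in RHS](odd_double_half n).
by case: (odd n); rewrite ?add1n ?add0n.
Qed.
Lemma col_tuple p i : col (tuple_of p) i = p i.
Proof. by apply/funext => j; rewrite /col /tuple_of npairK1 npairK2. Qed.
Lemma tuple_col s : tuple_of (col s) = s.
Proof. by apply/funext => n; rewrite /col /tuple_of npair_surj. Qed.
Lemma stl_scons k s : stl (scons k s) = s.
Proof. by []. Qed.
(* Total functionals, recursive uniformly in an oracle: g computes the value from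
   a prefix of the oracle as soon as d recognizes that prefix as sufficient. *)
Definition orec A B {cA : coded A} {cB : coded B} (F : baire -> A -> B) : Prop :=
  exists (d : word -> A -> bool) (g : word -> A -> B), [/\ rec2 d, rec2 g,
    forall p a m, d (mkseq p m) a -> g (mkseq p m) a = F p a &
    forall p a, exists m0, forall m, m0 <= m -> d (mkseq p m) a].

Lemma orec_lift A B {cA : coded A} {cB : coded B} (f : A -> B) :
  rec f -> orec (fun _ => f).
Proof.
move=> rf; exists (fun _ _ => true), (fun _ => f); split=> //; rewrite /rec2;
  try by rec_tac.
by move=> p a; exists 0.
Qed.

Lemma orec_app A B C {cA : coded A} {cB : coded B} {cC : coded C}
  (F : baire -> B -> C) (h : baire -> A -> B) :
  orec F -> orec h -> orec (fun p a => F p (h p a)).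
Proof.
move=> [d [g [rd rg hg hd]]] [d' [g' [rd' rg' hg' hd']]].
exists (fun w a => d' w a && d w (g' w a)), (fun w a => g w (g' w a)); split.
- by rewrite /rec2; rec_tac.
- by rewrite /rec2; rec_tac.
- by move=> p a m /andP[/hg' -> /hg].
- move=> p a; have [m0 h0] := hd' p a; have [m1 h1] := hd p (h p a).
  exists (maxn m0 m1) => m; rewrite geq_max => /andP[/h0 dm /h1].
  by rewrite hg' // dm.
Qed.

Lemma orec_comp A B C {cA : coded A} {cB : coded B} {cC : coded C}
  (op : B -> C) (h : baire -> A -> B) :
  rec op -> orec h -> orec (fun p a => op (h p a)).
Proof. by move=> /orec_lift; exact: orec_app. Qed.

Lemma orec_pair A B C {cA : coded A} {cB : coded B} {cC : coded C}
  (f : baire -> A -> B) (h : baire -> A -> C) :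
  orec f -> orec h -> orec (fun p a => (f p a, h p a)).
Proof.
move=> [d [g [rd rg hg hd]]] [d' [g' [rd' rg' hg' hd']]].
exists (fun w a => d' w a && d w a), (fun w a => (g w a, g' w a)); split.
- by rewrite /rec2; rec_tac.
- by rewrite /rec2; rec_tac.
- by move=> p a m /andP[/hg' -> /hg ->].
- move=> p a; have [m0 h0] := hd' p a; have [m1 h1] := hd p a.
  by exists (maxn m0 m1) => m; rewrite geq_max => /andP[/h0 -> /h1 ->].
Qed.

Lemma orec_app2 A B C D {cA : coded A} {cB : coded B} {cC : coded C} {cD : coded D}
  (op : B -> C -> D) (f : baire -> A -> B) (g : baire -> A -> C) :
  rec2 op -> orec f -> orec g -> orec (fun p x => op (f p x) (g p x)).
Proof. by move=> rop rf rg; exact: orec_comp rop (orec_pair rf rg). Qed.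

Lemma orec_if A B {cA : coded A} {cB : coded B} (c : baire -> A -> bool)
  (f g : baire -> A -> B) :
  orec c -> orec f -> orec g -> orec (fun p x => if c p x then f p x else g p x).
Proof.
move=> rc rf rg.
apply: (orec_comp (op := fun x : bool * (B * B) => if x.1 then x.2.1 else x.2.2)
  _ (orec_pair rc (orec_pair rf rg))).
by rec_tac.
Qed.

Lemma orec_oracle A {cA : coded A} (h : baire -> A -> nat) :
  orec h -> orec (fun p a => p (h p a)).
Proof.
apply: (orec_app (F := fun p n => p n)).
exists (fun w n => n.+1 <= size w), (fun w n => nth 0 w n); split.
- by rewrite /rec2; rec_tac.
- by rewrite /rec2; rec_tac.
- by move=> p n m; rewrite size_mkseq => nm; rewrite nth_mkseq.
- by move=> p n; exists n.+1 => m; rewrite size_mkseq.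
Qed.

Lemma orec_mkseq A {cA : coded A} (F : baire -> A -> nat -> nat) (n : baire -> A -> nat) :
  orec n -> orec (fun p (x : A * nat) => F p x.1 x.2) ->
  orec (fun p a => mkseq (F p a) (n p a)).
Proof.
move=> on [d [g [rd rg hg hd]]].
apply: (@orec_app _ (A * nat) _ _ _ _ (fun p x => mkseq (F p x.1) x.2) (fun p a => (a,
  n p a))); last first.
  by apply: orec_pair => //; apply: orec_lift; rec_tac.
exists (fun w x => x.2 <= find (fun i => ~~ d w (x.1, i)) (mkseq id x.2)),
       (fun w x => mkseq (fun i => g w (x.1, i)) x.2); split.
- by rewrite /rec2; rec_tac.
- by rewrite /rec2; rec_tac.
- move=> p [a k] m /= h; apply: (@eq_from_nth _ 0); rewrite !size_mkseq // => i ik.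
  rewrite !nth_mkseq // hg //.
  have /negbFE := before_find 0 (leq_trans ik h).
  by rewrite nth_mkseq.
- move=> p [a k] /=.
  have [m0 hm0] : exists m0, forall m, m0 <= m -> forall i, i < k -> d (mkseq p m) (a, i).
    elim: k => [|k [m0 IH]]; first by exists 0.
    have [m1 h1] := hd p (a, k); exists (maxn m0 m1) => m;
      rewrite geq_max => /andP[u v] i.
    by rewrite ltnS leq_eqVlt => /predU1P[->|]; [exact: h1 | exact: IH].
  exists m0 => m /hm0 h; rewrite leqNgt; apply/negP => lt.
  have hf : find (fun i => ~~ d (mkseq p m) (a, i)) (mkseq id k) < size (mkseq id k).
    by rewrite size_mkseq.
  have := hf; rewrite -has_find => /(nth_find 0); rewrite nth_mkseq // => /negP; apply.
  exact: h.
Qed.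

Definition computable_fun (T : baire -> baire) := computable (fun p => [set T p]).

Lemma computable_fun_orec T : orec T -> computable_fun T.
Proof.
move=> [d [g [rd rg hg hd]]]; apply: computable_digits rd rg _ => p r ->.
by split=> [m n /hg|n //].
Qed.

Lemma computable_fun_comp S T : computable_fun S -> computable_fun T ->
  computable_fun (fun p => S (T p)).
Proof.
move=> cS cT; apply: computable_sub (computable_comp cT cS) _ => p r ->.
by exists (T p).
Qed.

#[local] Hint Unfold evens odds col scons stl bpair tuple_of : orec.

Ltac orec_step :=
  cbv beta;
  lazymatch goal with
  | |- orec (fun _ => ?f) => refine (orec_lift _); rec_tac
  | |- orec (fun p c => p (@?h p c)) => refine (@orec_oracle _ _ h _)
  | |- orec (fun p c => mkseq (@?f p c) (@?n p c)) =>
      refine (@orec_mkseq _ _ f n _ _)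
  | |- orec (fun p c => ?op (@?f p c) (@?g p c)) =>
      (refine (@orec_app2 _ _ _ _ _ _ _ _ op f g _ _ _); [solve [auto with rec] | |]) ||
      (refine (@orec_comp _ _ _ _ _ _ (op _) g _ _); [solve [auto with rec] |])
  | |- orec (fun p c => ?op (@?f p c)) =>
      refine (@orec_comp _ _ _ _ _ _ op f _ _); [solve [auto with rec] |]
  | |- orec (fun p c => _) => refine (@orec_if _ _ _ _ _ _ _ _ _ _)
  end.
Ltac orec_tac :=
  lazymatch goal with |- orec ?F => refine (_ : orec (fun p a => F p a)) end;
  cbv beta; repeat autounfold with orec; repeat orec_step.

Lemma computable_fun_id : computable_fun (fun p => p).
Proof. by apply: computable_fun_orec; orec_tac. Qed.
Lemma computable_fun_evens : computable_fun evens.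
Proof. by apply: computable_fun_orec; orec_tac. Qed.
Lemma computable_fun_odds : computable_fun odds.
Proof. by apply: computable_fun_orec; orec_tac. Qed.

(** * Pairing and columns on finite words *)

Definition evens_word (w : word) : word := mkseq (fun n => nth 0 w n.*2) (size w)./2.
Definition odds_word (w : word) : word := mkseq (fun n => nth 0 w n.*2.+1) (size w)./2.
Definition interleave (u v : word) : word :=
  mkseq (fun n => if odd n then nth 0 v n./2 else nth 0 u n./2)
    (minn (size u) (size v)).*2.

Lemma rec_evens_word : rec evens_word. Proof. by rewrite /evens_word; rec_tac. Qed.
Lemma rec_odds_word : rec odds_word. Proof. by rewrite /odds_word; rec_tac. Qed.
Lemma rec_interleave : rec2 interleave. Proof. by rewrite /rec2 /interleave; rec_tac. Qed.
#[local] Hint Resolve rec_evens_word rec_odds_word rec_interleave : rec.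

Lemma ltn_half_double i n : i < n./2 -> i.*2.+1 < n.
Proof. by rewrite geq_half_double doubleS. Qed.

Lemma initial_evens_word w s : initial w s -> initial (evens_word w) (evens s).
Proof.
move=> /initialP h; apply/initialP => i; rewrite size_mkseq => hi.
by rewrite nth_mkseq // h // ltnW // ltn_half_double.
Qed.

Lemma initial_odds_word w s : initial w s -> initial (odds_word w) (odds s).
Proof.
move=> /initialP h; apply/initialP => i; rewrite size_mkseq => hi.
by rewrite nth_mkseq // h // ltn_half_double.
Qed.

Lemma initial_interleave u v p q : initial u p -> initial v q ->
  initial (interleave u v) (bpair p q).
Proof.
move=> /initialP hu /initialP hv; apply/initialP => i; rewrite size_mkseq => hi.
rewrite nth_mkseq // /bpair.
have : i./2 < minn (size u) (size v) by rewrite -ltn_double (leq_ltn_trans _ hi) //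
  -[leqRHS]odd_double_half leq_addl.
by rewrite leq_min => /andP[/hu -> /hv ->].
Qed.

Lemma computable_juxt F G : computable F -> computable G -> computable (juxt F G).
Proof.
move=> /computableE[phi [mphi rphi hphi]] /computableE[psi [mpsi rpsi hpsi]].
apply: (computableI (g := fun w => interleave (phi w) (psi w))); first by rec_tac.
move=> p _ [q [r [/hphi hq /hpsi hr ->]]]; split=> [m|n].
  by apply: initial_interleave; [apply: (proj1 hq) | apply: (proj1 hr)].
have [m0 h0] := approximates_large mphi hq n.
have [m1 h1] := approximates_large mpsi hr n.
exists (maxn m0 m1); rewrite size_mkseq -addnn; apply: leq_trans (leq_addr _ _).
by rewrite leq_min h0 ?leq_maxl // h1 // leq_maxr.
Qed.

Lemma computable_fun_bpair S T : computable_fun S -> computable_fun T ->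
  computable_fun (fun p => bpair (S p) (T p)).
Proof.
move=> cS cT; apply: computable_sub (computable_juxt cS cT) _ => p r ->.
by exists (S p), (T p).
Qed.

Definition col_word (w : word) (i : nat) : word :=
  mkseq (fun l => nth 0 w (npair i l))
    (find (fun l => size w <= npair i l) (mkseq id (size w))).
Lemma rec_col_word : rec2 col_word. Proof. by rewrite /rec2 /col_word; rec_tac. Qed.
#[local] Hint Resolve rec_col_word : rec.

(** [npair i] is monotone, so the first missing entry of column [i] separates all known entries from
    all missing ones. *)
Lemma size_col_word w i l : (l < size (col_word w i)) = (npair i l < size w).
Proof.
rewrite size_mkseq; apply/idP/idP => [h|].
  have := before_find 0 h; rewrite nth_mkseq => [/negbT|]; first by rewrite -ltnNge.
  by apply: leq_trans h _; rewrite -[leqRHS](size_mkseq id) find_size.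
move=> h; rewrite ltnNge; apply/negP => le.
have lt : l < size (mkseq id (size w)).
  by rewrite size_mkseq; apply: leq_ltn_trans (leq_npair2 i l) h.
have hf := leq_ltn_trans le lt.
have := hf; rewrite -has_find => /(nth_find 0); rewrite nth_mkseq;
  last by rewrite size_mkseq in hf.
rewrite leqNgt => /negP; apply; apply: leq_ltn_trans h.
exact: npair_mono.
Qed.

Lemma nth_col_word w i l : npair i l < size w ->
  nth 0 (col_word w i) l = nth 0 w (npair i l).
Proof. by rewrite -size_col_word size_mkseq => h; rewrite nth_mkseq. Qed.

Lemma initial_col_word w s i : initial w s -> initial (col_word w i) (col s i).
Proof.
move=> /initialP h; apply/initialP => l; rewrite size_col_word => hl.
by rewrite nth_col_word // h.
Qed.

Lemma col_word_large i n : exists m0, forall s m, m0 <= m ->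
  n <= size (col_word (mkseq s m) i).
Proof.
exists (npair i n) => s m h; case: n h => // n h.
rewrite size_col_word size_mkseq; apply: leq_trans h.
by rewrite -ltnS !npairS ltn_pmul2l ?expn_gt0 // ltnS ltn_double.
Qed.

Definition parallel (F : mvf baire baire) : mvf baire baire :=
  fun s => [set t | forall i, F (col s i) (col t i)].

Lemma computable_parallel F : computable F -> computable (parallel F).
Proof.
move=> /computableE[phi [mphi rphi hphi]].
apply: (@computable_digits _
  (fun w n => (nsnd n).+1 <= size (phi (col_word w (nfst n))))
  (fun w n => nth 0 (phi (col_word w (nfst n))) (nsnd n))).
- by rewrite /rec2; rec_tac.
- by rewrite /rec2; rec_tac.
move=> p r h; split=> [m|] n; have := hphi _ _ (h (nfst n)).
  set c := col_word _ _; have -> : c = mkseq (col p (nfst n)) (size c).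
    exact: (initial_col_word _ (initial_mkseq p m)).
  by move=> [/(_ (size c))/initialP hc _] /hc ->; rewrite /col npair_surj.
move=> /(approximates_large mphi)/(_ (nsnd n).+1)[m0 h0].
have [m1 h1] := col_word_large (nfst n) m0; exists m1 => m /(h1 p).
set c := col_word _ _; have -> : c = mkseq (col p (nfst n)) (size c).
  exact: (initial_col_word _ (initial_mkseq p m)).
by rewrite size_mkseq; exact: h0.
Qed.

Lemma computable_fun_parallel T : computable_fun T ->
  computable_fun (fun p => tuple_of (fun i => T (col p i))).
Proof.
move=> /computable_parallel h; apply: computable_sub h _ => p r -> i.
exact: col_tuple.
Qed.

(** * The universal function *)

Lemma UE s r : U s r <-> Phi (evens s) (odds s) r.
Proof.
split=> [[q [p [-> h]]]|h]; first by rewrite evens_bpair odds_bpair.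
by exists (evens s), (odds s); rewrite bpairE.
Qed.

Lemma U_bpair q p r : U (bpair q p) r <-> Phi q p r.
Proof. by rewrite UE evens_bpair odds_bpair. Qed.

Definition entry_arg (d : nat) : word := CodeSeq.decode (nfst (d - 3)).
Definition entry_val (d : nat) : word := CodeSeq.decode (nsnd (d - 3)).
Definition entry (u v : word) : nat := (npair (CodeSeq.code u) (CodeSeq.code v)).+3.
Lemma entry_argK u v : entry_arg (entry u v) = u.
Proof. by rewrite /entry_arg /entry subSS subSS subSS subn0 npairK1 CodeSeq.codeK. Qed.
Lemma entry_valK u v : entry_val (entry u v) = v.
Proof. by rewrite /entry_val /entry subSS subSS subSS subn0 npairK2 CodeSeq.codeK. Qed.
Lemma entryK d : 2 < d -> entry (entry_arg d) (entry_val d) = d.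
Proof.
by move: d => [|[|[|d]]] // _; rewrite /entry /entry_arg /entry_val !CodeSeq.decodeK
  !subSS subn0 npair_surj.
Qed.
Lemma rec_entry_arg : rec entry_arg. Proof. by rewrite /entry_arg; rec_tac. Qed.
Lemma rec_entry_val : rec entry_val. Proof. by rewrite /entry_val; rec_tac. Qed.
Lemma rec_entry : rec2 entry. Proof. by rewrite /rec2 /entry; rec_tac. Qed.
#[local] Hint Resolve rec_entry_arg rec_entry_val rec_entry : rec.

(** On the domain of [U] all applicable values are compatible, so a longest one contains the others.
    Off the domain the result need not be monotone in [w]. *)
Definition Uw (w : word) : word :=
  iteri (size (evens_word w)) (fun i o =>
    if (3 <= nth 0 (evens_word w) i) &&
      prefix (entry_arg (nth 0 (evens_word w) i)) (odds_word w)
       && (size o <= size (entry_val (nth 0 (evens_word w) i)))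
    then entry_val (nth 0 (evens_word w) i) else o) [::].

Lemma rec_Uw : rec Uw.
Proof. by rewrite /Uw; rec_tac. Qed.

Lemma Uw_approximates s r : U s r -> approximates Uw s r.
Proof.
rewrite UE => -[hr hn].
have h w : initial w s -> forall k, k <= size (evens_word w) ->
   let o := iteri k (fun i o =>
    if (3 <= nth 0 (evens_word w) i) &&
      prefix (entry_arg (nth 0 (evens_word w) i)) (odds_word w)
       && (size o <= size (entry_val (nth 0 (evens_word w) i)))
    then entry_val (nth 0 (evens_word w) i) else o) [::] in
   initial o r /\ forall i, i < k -> 3 <= nth 0 (evens_word w) i ->
     prefix (entry_arg (nth 0 (evens_word w) i)) (odds_word w) ->
       size (entry_val (nth 0 (evens_word w) i)) <= size o.
  move=> iw; elim=> [//|k IH] kw /=.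
  have /= [io so] := IH (ltnW kw); set o := iteri _ _ _ in io so *.
  have /initialP ec := initial_evens_word iw.
  case: ifP => [/andP[/andP[d3 pre] le]|cond]; split=> //.
  - apply: hr; exists (entry_arg (nth 0 (evens_word w) k)).
      exact: prefix_initial pre (initial_odds_word iw).
    by exists k; rewrite -ec // -/(entry _ _) entryK.
  - move=> i; rewrite ltnS leq_eqVlt => /predU1P[->//|ik] di pi.
    exact: leq_trans (so i ik di pi) le.
  - move=> i; rewrite ltnS leq_eqVlt => /predU1P[->|ik] di pi; last exact: so.
    by move: cond; rewrite di pi /= leqNgt => /negbFE/ltnW.
split=> [m|n].
  by have [] := h _ (initial_mkseq s m) _ (leqnn _).
have [v [u iu [i qi]] nv] := hn n.
exists (maxn i.+1 (size u)).*2; set m := maxn _ _; set w := mkseq s m.*2.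
have sw : size w = m.*2 by rewrite size_mkseq.
have iw : initial w s by exact: initial_mkseq.
have [_ /(_ i)] := h w iw _ (leqnn _).
have im : i < size (evens_word w) by rewrite size_mkseq sw doubleK leq_maxl.
have /initialP/(_ i im) -> := initial_evens_word iw.
move=> /(_ im); rewrite qi -/(entry u v) entry_argK entry_valK => /(_ isT) hh.
apply: leq_trans nv (hh _).
apply: initial_prefix iu (initial_odds_word iw) _.
by rewrite size_mkseq sw doubleK leq_maxr.
Qed.

Lemma computable_U : computable U.
Proof. by apply: computableI rec_Uw _ => p r; exact: Uw_approximates. Qed.

Definition name (phi : word -> word) : baire :=
  fun n => entry (CodeSeq.decode n) (phi (CodeSeq.decode n)).

Lemma rec_name phi : rec phi -> rec (name phi).
Proof. by move=> rphi; rewrite /name; rec_tac. Qed.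

Lemma Phi_name phi p r : approximates phi p r -> Phi (name phi) p r.
Proof.
move=> [hi hs]; split=> [v [u -> [n qn]]|n].
  have := congr1 entry_val qn; rewrite -/(entry _ _) !entry_valK => <-.
  by have := congr1 entry_arg qn; rewrite -/(entry _ _) !entry_argK => ->.
have [m hm] := hs n; exists (phi (mkseq p m)) => //; exists (mkseq p m).
  exact: initial_mkseq.
by exists (CodeSeq.code (mkseq p m)); rewrite /name CodeSeq.codeK.
Qed.

Lemma computable_fun_const e : rec e -> computable_fun (fun _ => e).
Proof. by move=> re; apply: computable_fun_orec; apply: orec_lift. Qed.

Lemma computable_Phi e (F : mvf baire baire) : rec e ->
  (forall p r, F p r -> Phi e p r) -> computable F.
Proof.
move=> re h.
apply: computable_sub (computable_comp (computable_fun_bpair (computable_fun_const re)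
  computable_fun_id) computable_U) _.
by move=> p r /h hp; exists (bpair e p) => //; apply/U_bpair.
Qed.

Lemma computable_has_name F : computable F ->
  exists2 e, rec e & forall p r, F p r -> Phi e p r.
Proof.
move=> /computableE[phi [_ rphi h]]; exists (name phi); first exact: rec_name.
by move=> p r /h /Phi_name.
Qed.

(** * Turing reducibility *)

Lemma turing_le_trans q p r : turing_le p q -> turing_le q r -> turing_le p r.
Proof.
move=> [F cF Fqp] [G cG Grq].
by exists (fun p => [set r | exists2 q, G p q & F q r]);
  [exact: computable_comp | exists q].
Qed.
Lemma turing_le_computable_fun T p : computable_fun T -> turing_le (T p) p.
Proof. by move=> cT; exists (fun p => [set T p]). Qed.
Lemma turing_le_refl p : turing_le p p.
Proof. exact: turing_le_computable_fun computable_fun_id. Qed.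
Lemma turing_le_bpair p q r : turing_le p r -> turing_le q r -> turing_le (bpair p q) r.
Proof.
move=> [F cF Fp] [G cG Gp]; exists (juxt F G); first exact: computable_juxt.
by exists p, q.
Qed.
Lemma turing_le_U s r z : turing_le s z -> U s r -> turing_le r z.
Proof.
by move=> sz sr; apply: turing_le_trans sz; exists U => //; exact: computable_U.
Qed.
Lemma turing_le_rec e z : rec e -> turing_le e z.
Proof. by move=> /computable_fun_const; exact: turing_le_computable_fun. Qed.

(** * The recursion theorem for names *)

(* y = <e, x> is read as the program e with its first argument x fixed. *)
Definition smn (y : baire) : baire := fun n =>
  if (3 <= evens y (nfst n)) &&
     prefix (entry_arg (evens y (nfst n)))
       (interleave (mkseq y (size (entry_arg (evens y (nfst n))))) (CodeSeq.decode
         (nsnd n)))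
  then entry (CodeSeq.decode (nsnd n)) (entry_val (evens y (nfst n))) else 0.

(* The digit (npair k 0).+3 lists the empty word as a value and is thus harmless
   in a name, so that a name can carry data; 0 stays the dummy 0, because the
   first digit of a name decides whether a run of f^diamond stops. *)
Definition hide_digits (x : baire) : baire :=
  fun n => if x n == 0 then 0 else (npair (x n) 0).+3.
Definition show_digits (x : baire) : baire :=
  fun n => if x n == 0 then 0 else nfst (x n - 3).

Lemma hide_digitsK x : show_digits (hide_digits x) = x.
Proof.
apply/funext => n; rewrite /show_digits /hide_digits; case: (x n) => [|k] //=.
by rewrite !subSS subn0 npairK1.
Qed.

Definition code_state (y : baire) : baire := bpair (hide_digits (odds y)) (smn y).
Definition state_of (c : baire) : baire := show_digits (evens c).

Lemma computable_fun_code_state : computable_fun code_state.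
Proof.
by apply: computable_fun_orec; rewrite /code_state /smn /hide_digits; orec_tac.
Qed.

Lemma computable_fun_state_of : computable_fun state_of.
Proof. by apply: computable_fun_orec; rewrite /state_of /show_digits; orec_tac. Qed.

Lemma code_stateK y : state_of (code_state y) = odds y.
Proof. by rewrite /state_of evens_bpair hide_digitsK. Qed.

Lemma initial_app u p i : initial u p -> i < size u -> nth 0 u i = p i.
Proof. by move=> /initialP; apply. Qed.

(** The even digits of [code_state y] are dummies or list the empty word, so only [smn y]
    contributes. The program [evens y] receives all of [y], and thus its own name: this is the
    self-reference behind the recursion theorem. *)
Lemma Phi_code_state y t r : Phi (evens y) (bpair y t) r -> Phi (code_state y) t r.
Proof.
move=> [hr hn]; split=> [v [u iu [n]]|n].
  rewrite -/(entry u v) /code_state /bpair; case: (odd n); rewrite /hide_digits /smn.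
    set d := evens y _; case: ifP => // /andP[d3 pre] e.
    have eu := congr1 entry_arg e; have ew := congr1 entry_val e.
    rewrite !(entry_argK, entry_valK) in eu ew; rewrite -ew; apply: hr.
    exists (entry_arg d); last by exists (nfst n./2); rewrite -/(entry _ _) entryK.
    by apply: prefix_initial pre _; apply: initial_interleave;
      [exact: initial_mkseq | rewrite eu].
  case: ifP => // _ [] /(congr1 nsnd); rewrite !npairK2 => e.
  by rewrite (_ : v = [::]) //; apply: (can_inj CodeSeq.codeK); rewrite -e.
have [v [w iw [i qi]] nv] := hn n; exists v => //.
(* Interleaving two prefixes of length [size w] gives twice that length, enough to contain [w]. *)
exists (mkseq t (size w)); first exact: initial_mkseq.
exists (npair i (CodeSeq.code (mkseq t (size w)))).*2.+1.
rewrite -/(entry _ _) /code_state /bpair /= odd_double /= uphalf_double /smn npairK1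
  npairK2.
rewrite qi -/(entry w v) entry_argK entry_valK CodeSeq.codeK ifT //.
rewrite {1}/entry /=; apply: initial_prefix iw _ _.
  by apply: initial_interleave; exact: initial_mkseq.
by rewrite size_mkseq !size_mkseq minnn -addnn leq_addr.
Qed.

(* The recursion theorem: a name e of the functional
   <<e, x>, t> |-> <code_state <e, x'>, s'> is passed to itself. *)
Lemma machine pre post : computable_fun pre -> computable_fun post ->
  exists N : baire -> baire,
  [/\ computable_fun N, forall x, N x 0 = 0 <-> x 0 = 0, forall x, state_of (N x) = x &
    forall x t y, U (pre (bpair x t)) y ->
      let z := post (bpair (bpair x t) y) in
      Phi (N x) t (bpair (N (evens z)) (odds z))].
Proof.
move=> cpre cpost.
(* Inputs have the form <<e, x>, t>. [xt] drops the program e before [pre] and [post] are applied,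
   and [fin] puts it back to form the name of the new state. *)
pose xt (s : baire) := bpair (odds (evens s)) (odds s).
pose fin (s : baire) := let z := post (bpair (xt (evens s)) (odds s)) in
  bpair (code_state (bpair (evens (evens (evens s))) (evens z))) (odds z).
have cxt : computable_fun xt.
  apply: computable_fun_bpair computable_fun_odds;
    exact: computable_fun_comp computable_fun_odds computable_fun_evens.
have cfin : computable_fun fin.
  have cz : computable_fun (fun s => post (bpair (xt (evens s)) (odds s))).
    apply: (computable_fun_comp cpost); apply: computable_fun_bpair computable_fun_odds.
    exact: computable_fun_comp cxt computable_fun_evens.
  apply: computable_fun_bpair; last exact: computable_fun_comp computable_fun_odds cz.
  apply: (computable_fun_comp computable_fun_code_state); apply: computable_fun_bpair;
    last exact: computable_fun_comp computable_fun_evens cz.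
  by apply: (computable_fun_comp computable_fun_evens);
    apply: (computable_fun_comp computable_fun_evens); exact: computable_fun_evens.
have [e re eP] := computable_has_name (computable_comp
   (computable_juxt computable_fun_id (computable_comp (computable_fun_comp cpre cxt)
     computable_U)) cfin).
exists (fun x => code_state (bpair e x)); split.
- apply: (computable_fun_comp computable_fun_code_state);
  exact: computable_fun_bpair (computable_fun_const re) computable_fun_id.
- move=> x; rewrite /code_state {1}/bpair /= /hide_digits odds_bpair.
  by case: eqP.
- by move=> x; rewrite code_stateK odds_bpair.
- move=> x t y Uy z; apply: Phi_code_state; rewrite evens_bpair; apply: eP.
  exists (bpair (bpair (bpair e x) t) y).
    exists (bpair (bpair e x) t), y; split=> //.
    by exists (pre (bpair x t)); rewrite // /xt !evens_bpair !odds_bpair.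
  by rewrite /fin /xt !(evens_bpair, odds_bpair).
Qed.

(** The left 0 is the code of the empty word: all prefixes of [p] are listed for the empty
    argument. *)
Definition constant_name (p : baire) : baire := fun n =>
  (npair 0 (CodeSeq.code (mkseq p n))).+3.
Lemma Phi_constant_name p t : Phi (constant_name p) t p.
Proof.
split=> [v [u _ [n]]|n].
  rewrite /constant_name => -[] /(congr1 nsnd); rewrite !npairK2.
  by move=> /(can_inj CodeSeq.codeK) <-; exact: initial_mkseq.
exists (mkseq p n); last by rewrite size_mkseq.
by exists [::] => //; exists n.
Qed.

(** * Reducing omega to diamond *)

Lemma id_timesE f s t : id_times f s t <-> evens t = evens s /\ f (odds s) (odds t).
Proof.
split=> [[q [p [r [-> fpr ->]]]]|[e h]]; first by rewrite !evens_bpair !odds_bpair.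
by exists (evens s), (odds s), (odds t); split=> //; [rewrite bpairE | rewrite -e bpairE].
Qed.

Lemma mdom_id_times f s : mdom (id_times f) s <-> mdom f (odds s).
Proof.
split=> [[t /id_timesE[_ h]]|[t h]]; first by exists (odds t).
by exists (bpair (evens s) t); apply/id_timesE; rewrite evens_bpair odds_bpair.
Qed.

Lemma LE f q z : L f q z <->
  (forall t, f (odds q) t -> exists r, Phi (evens q) t r) /\
  exists2 t, f (odds q) t & Phi (evens q) t z.
Proof.
split=> [[h [y /id_timesE[e fy] /UE Uyz]]|[h [t ft Pz]]].
  split; last by exists (odds y) => //; rewrite -e.
  move=> t ft; have /h[r /U_bpair Pr] : id_times f q (bpair (evens q) t).
    by apply/id_timesE; rewrite evens_bpair odds_bpair.
  by exists r.
split; last first.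
  exists (bpair (evens q) t); last exact/U_bpair.
  by apply/id_timesE; rewrite evens_bpair odds_bpair.
move=> y /id_timesE[e /h[r Pr]]; exists r; apply/UE; by rewrite e.
Qed.

Lemma mdom_LE f q : mdom (L f) q <->
  mdom f (odds q) /\ forall t, f (odds q) t -> exists r, Phi (evens q) t r.
Proof.
split=> [[z /LE[h [t ft _]]]|[[t ft] h]]; first by split=> //; exists t.
by have [r Pr] := h t ft; exists r; apply/LE; split=> //; exists t.
Qed.

Lemma mcomp_mid X Y (f : mvf X Y) : mcomp f (@mid X) = f.
Proof.
apply/funext => x; apply/seteqP; split=> [y [_ [_ -> //]]|y fxy].
by split; [move=> _ ->; exists y | exists x].
Qed.

Lemma delta_seq_baire s (y : nat -> baire) : @seq_delta baire_space s y <-> y = col s.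
Proof.
split=> [[p -> px]|->]; last by exists (col s) => //; rewrite tuple_col.
by apply/funext => i; rewrite col_tuple (px i).
Qed.

Lemma mcomp_parallelization (h : mvf baire baire) s y :
  mcomp (values (parallelization (on_baire h)))
    (@delta (source (parallelization (on_baire h)))) s y <->
  forall i, h (col s i) (y i).
Proof.
split=> [[_ [x /delta_seq_baire -> //]]|hy].
by split; [move=> x /delta_seq_baire ->; exists y | exists (col s) => //;
  apply/delta_seq_baire].
Qed.

(** A realizer enters only through its value at the single point [k], and this value is a name of
    some solution. Treating every name of every solution therefore covers all realizers. *)
Lemma lesWI (f g : problem) H K : computable_fun H -> computable K ->
  (forall p, mdom (mcomp f (@delta (source f))) p -> exists2 k, K p k &
     mdom (mcomp g (@delta (source g))) k /\
     forall r y, delta r y -> mcomp g (@delta (source g)) k y ->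
       exists2 z, delta (H r) z & mcomp f (@delta (source f)) p z) ->
  lesW f g.
Proof.
move=> cH cK h; exists (fun p => [set H p]), K; split=> // G [sG gG]; split.
  move=> p y z [_ [u [_ [v Kv Gu]] ->]] [_ [u' [_ [v' Kv' Gu']] ->]].
  have vv' := computable_single_valued cK Kv Kv'; rewrite -vv' in Gu'.
  by rewrite (sG _ _ _ Gu Gu').
move=> p /h[k Kpk [dk hk]].
have [y [dG [r Gr ry]] gy] := gG k dk.
have [z Hz fz] := hk r y ry gy; exists z => //.
have Kk k' : K p k' -> k' = k by move=> /(computable_single_valued cK Kpk).
have GK r' : mcomp G K p r' -> r' = r.
  by move=> [_ [k' /Kk -> Gr']]; exact: sG Gr' Gr.
have HGK : mcomp (fun p => [set H p]) (mcomp G K) p (H r).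
  split; first by move=> r' _; exists (H r').
  exists r => //; split; last by exists k.
  by move=> k' /Kk ->; exists r.
split; last by exists (H r).
by move=> _ [_ [r' /GK -> ->]]; exists z.
Qed.

(* The n-th state of a run: iterate f n.+1 is id_times f after stage f n. *)
Definition stage (f : mvf baire baire) (n : nat) : mvf baire baire :=
  if n is 0 then @mid baire else mcomp U (iterate f n).

Lemma iterateS f n : iterate f n.+1 = mcomp (id_times f) (stage f n).
Proof. by case: n => //; rewrite /= mcomp_mid. Qed.

Section OmegaDomain.
Variables (f : mvf baire baire) (p : baire).
Hypothesis dp : forall n, mdom (iterate f n) p.

Lemma stage_query n z : stage f n p z -> mdom f (odds z).
Proof.
move=> pz; apply/mdom_id_times.
by have := dp n.+1; rewrite iterateS => -[_ [h _]]; exact: h.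
Qed.

Lemma iterateSE n r : iterate f n.+1 p r <->
  exists z, [/\ stage f n p z, evens r = evens z & f (odds z) (odds r)].
Proof.
rewrite iterateS; split=> [[_ [z pz /id_timesE[e h]]]|[z [pz e h]]].
  by exists z.
split; last by exists z => //; apply/id_timesE.
by move=> z' /stage_query h'; apply/mdom_id_times.
Qed.

Lemma stage_answer n z t : stage f n p z -> f (odds z) t ->
  exists z', Phi (evens z) t z'.
Proof.
(* The level [n.+2] is needed since its domain condition is the one that demands [U] to be defined
   on all values of [iterate f n.+1]. *)
move=> pz ft; have := dp n.+2; rewrite iterateS => -[_ [_ [_ [h _] _]]].
have /h[z' /U_bpair Pz'] : iterate f n.+1 p (bpair (evens z) t).
  by apply/iterateSE; exists z; rewrite evens_bpair odds_bpair.
by exists z'.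
Qed.

Lemma stage_step n z t z' : stage f n p z -> f (odds z) t -> Phi (evens z) t z' ->
  stage f n.+1 p z'.
Proof.
move=> pz ft Pz'; split; last first.
  exists (bpair (evens z) t); last exact/U_bpair.
  by apply/iterateSE; exists z; rewrite evens_bpair odds_bpair.
move=> r /iterateSE[y [py e /(stage_answer py)[z'' Pz'']]].
by exists z''; apply/UE; rewrite e.
Qed.

End OmegaDomain.

(* States are k :: c, where k is the number of remaining queries and c the name of
   the simulated run; at k = 1 the answer itself is the result. *)
Definition count_pre (s : baire) : baire :=
  bpair (fun n => if evens s 0 <= 1 then constant_name (bpair (stl (evens s)) (odds s)) n
                  else stl (evens s) n) (odds s).
Definition count_post (s : baire) : baire :=
  bpair (scons (evens (evens s) 0).-1 (evens (odds s))) (odds (odds s)).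

Lemma computable_fun_count_pre : computable_fun count_pre.
Proof. by apply: computable_fun_orec; rewrite /count_pre /constant_name; orec_tac. Qed.
Lemma computable_fun_count_post : computable_fun count_post.
Proof. by apply: computable_fun_orec; rewrite /count_post; orec_tac. Qed.

(** At count 1 the answer [t] is not run through [c] but returned next to it, because a value of
    [iterate] is a program paired with its unprocessed answer. At higher counts [c] is simulated for
    one step. *)
Lemma count_machine : exists N : baire -> baire,
  [/\ computable_fun N, forall x, N x 0 = 0 <-> x 0 = 0, forall x, state_of (N x) = x,
    forall c t, Phi (N (scons 1 c)) t (bpair (N (scons 0 c)) t) &
    forall k c t y, Phi c t y ->
      Phi (N (scons k.+2 c)) t (bpair (N (scons k.+1 (evens y))) (odds y))].
Proof.
have [N [cN N0 NK NP]] := machine computable_fun_count_pre computable_fun_count_post.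
exists N; split=> // [c t|k c t y cty].
  have := NP (scons 1 c) t (bpair c t).
  rewrite /count_pre /count_post !(evens_bpair, odds_bpair, stl_scons); apply.
  by apply/U_bpair; exact: Phi_constant_name.
have := NP (scons k.+2 c) t y.
rewrite /count_pre /count_post !(evens_bpair, odds_bpair, stl_scons); apply.
exact/U_bpair.
Qed.

Lemma omega_le_diamond (f : problem) :
  lesW (omega_problem f) (parallelization (diamond_problem f)).
Proof.
have [N [cN N0 NK N1 N2]] := count_machine.
pose split_count (q : baire) := bpair (N (scons (q 0) (evens (stl q)))) (odds (stl q)).
pose K p := tuple_of (fun n => split_count (scons n p)).
pose H s := tuple_of (fun n => bpair (stl (state_of (evens (col s n)))) (odds (col s n))).
have csc : computable_fun split_count.
  apply: computable_fun_bpair.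
    apply: (@computable_fun_comp N (fun q => scons (q 0) (evens (stl q))) cN).
    by apply: computable_fun_orec; orec_tac.
  by apply: computable_fun_orec; orec_tac.
have cK : computable_fun K.
  have cD : computable_fun (fun p => tuple_of (fun n => scons n p)).
    by apply: computable_fun_orec; orec_tac.
  apply: computable_sub (computable_fun_comp (computable_fun_parallel csc) cD) _ =>
    p r ->.
  rewrite /K /=; congr tuple_of; apply/funext => n; by rewrite col_tuple.
have cH : computable_fun H.
  apply: (@computable_fun_parallel (fun z => bpair (stl (state_of (evens z))) (odds z))).
  apply: computable_fun_bpair computable_fun_odds; apply: (@computable_fun_comp stl);
    first by apply: computable_fun_orec; orec_tac.
  exact: computable_fun_comp computable_fun_state_of computable_fun_evens.
apply: (lesWI cH cK) => p; rewrite /= mcomp_mid => -[_ [r0 /= r0P _]].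
set F := realizer_version f in r0P *.
have dp n : mdom (iterate F n) p by exists (r0 n).
exists (K p) => //.
(* Shape of the states of the [n]-th instance: before the end, a state [z] of stage [i] wrapped with
   counter [n - i]; at the end, a value of [iterate F n] marked by counter 0. By [N0] the counter
   alone decides whether the run has stopped. *)
pose inv n i q := exists z, [/\ stage F i p z,
  i < n & q = bpair (N (scons (n - i) (evens z))) (odds z)].
pose fin n q := exists z t, iterate F n p (bpair z t) /\ q = bpair (N (scons 0 z)) t.
have colK n : col (K p) n = bpair (N (scons n (evens p))) (odds p) by rewrite col_tuple.
have inv_step n i q q' : inv n i q -> L F q q' -> inv n i.+1 q' \/ i.+1 = n /\ fin n q'.
  move=> [z [pz lt ->]] /LE[_ [t]]; rewrite evens_bpair odds_bpair => ft Pq'.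
  case: n lt Pq' => // n; rewrite ltnS leq_eqVlt => /predU1P[ein|lt] Pq'.
    right; rewrite -ein in Pq' *; split=> //; exists (evens z), t; split.
      by apply/(iterateSE dp); exists z; rewrite evens_bpair odds_bpair.
    by apply: Phi_single_valued Pq' _; rewrite subSnn; exact: N1.
  left; have [z' Pz'] := stage_answer dp pz ft.
  exists z'; split=> //; first exact: stage_step Pz'.
  move: lt Pq'; rewrite -subn_gt0 => lt Pq'.
  have e : n.+1 - i = (n - i).-1.+2 by rewrite subSn ?prednK // -ltnS ltnW // -subn_gt0.
  rewrite subSS -(prednK lt); apply: Phi_single_valued Pq' _.
  by rewrite e; exact: N2.
have inv_dom n i q : inv n i q -> mdom (L F) q.
  move=> [z [pz lt ->]]; apply/mdom_LE; rewrite evens_bpair odds_bpair.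
  split=> [|t ft]; first exact: stage_query pz.
  case e: (n - i) => [|[|k]].
  - by move: lt; rewrite -subn_gt0 e.
  - by eexists; exact: N1.
  - by have [z' Pz'] := stage_answer dp pz ft; eexists; exact: N2 Pz'.
have inv_run n (q : nat -> baire) k : q 0 = col (K p) n -> finite_run F q k ->
    (forall i, i < k -> q i 0 <> 0) -> inv n k (q k) \/ k = n /\ fin n (q k).
  move=> q0; elim: k => [|k IH] run nz.
    rewrite q0 colK; case: n q0 => [|n] q0.
      (* For [n = 0] the start already has counter 0, and the run without steps returns [p], the
         value of [iterate F 0]. *)
      right; split=> //; exists (evens p), (odds p); rewrite bpairE; split=> //.
    by left; exists p; rewrite subn0.
  have [||iv|[kn [z [t [_ e]]]]] := IH.
  - by move=> i ik; apply: run; exact: ltnW.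
  - by move=> i ik; apply: nz; exact: ltnW.
  - exact: inv_step iv (run _ _).
  - by have := nz k (ltnSn k); rewrite e /bpair /= => -[]; apply/N0.
have dom n : diamond_dom F (col (K p) n).
  move=> q q0; split=> [k [run nd nz]|[run nz]].
    have [|/inv_dom //|[_ [z [t [_ e]]]]] := inv_run n q k q0 run.
      by move=> i /ltnW; exact: nz.
    by have := nz k (leqnn k); rewrite e /bpair /= => -[]; apply/N0.
  have [||[z [_]]|[_ [z [t [_ e]]]]] := inv_run n q n q0.
  - by move=> i _; exact: run.
  - by move=> i _; exact: nz.
  - by rewrite ltnn.
  - by have := nz n; rewrite e /bpair /= => -[]; apply/N0.
have val n r : diamond F (col (K p) n) r -> fin n r.
  move=> [_ [q [k [q0 [run qk0 nz] ->]]]].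
  have [[z [_ lt e]]|[]//] := inv_run n q k q0 run nz.
  move: qk0; rewrite e /bpair /= => /N0; rewrite /scons /= => /eqP.
  by rewrite subn_eq0 leqNgt lt.
split.
  have /choice[y yP] n : exists y, diamond F (col (K p) n) y.
    by have := dom n; rewrite -mdom_diamond.
  by exists y; exact: (proj2 (@mcomp_parallelization (diamond F) _ _) yP).
move=> r y /delta_seq_baire -> /(@mcomp_parallelization (diamond F)) h.
exists (H r) => //; exists (fun n =>
  bpair (stl (state_of (evens (col r n)))) (odds (col r n))) => // n.
have [z [t [Iz ->]]] := val n _ (h n).
by rewrite evens_bpair odds_bpair NK stl_scons.
Qed.

(** * Reducing parallelized diamond to omega *)

Definition phiU : word -> word := monotonize Uw.

Lemma phiU_monotone : monotone_word phiU.
Proof. exact: monotonize_monotone. Qed.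
Lemma rec_phiU : rec phiU.
Proof. by have := rec_Uw; rewrite /phiU /monotonize => h; rec_tac. Qed.
#[local] Hint Resolve rec_phiU : rec.
Lemma phiU_approximates s r : U s r -> approximates phiU s r.
Proof. by move=> /Uw_approximates /monotonize_approximates. Qed.

(** A run of [L] on finite information: only the programs are executed, since the words [ws i] stand
    for the answers and the queries can be ignored. *)
Definition simulate (v : word) (ws : nat -> word) (k : nat) : word :=
  iteri k (fun i y => phiU (interleave (evens_word y) (ws i))) v.

Section Simulation.
Variables (k : nat) (q t : nat -> baire).
Hypothesis run : forall i, i < k -> U (bpair (evens (q i)) (t i)) (q i.+1).

Lemma simulate_initial v ws : initial v (q 0) -> (forall i, i < k ->
  initial (ws i) (t i)) ->
  forall j, j <= k -> initial (simulate v ws j) (q j).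
Proof.
move=> iv iw; elim=> [//|j IH] jk.
have [h _] := phiU_approximates (run jk).
have := initial_interleave (initial_evens_word (IH (ltnW jk))) (iw j jk).
by rewrite /simulate /= => ->.
Qed.

(** This is continuity of [U], iterated: the bound for [j.+1] steps comes from the bound that makes
    the program after [j] steps long enough. *)
Lemma simulate_large j l : j <= k -> exists a0, forall v ws, initial v (q 0) ->
  (forall i, i < k -> initial (ws i) (t i)) -> a0 <= size v ->
  (forall i, i < k -> a0 <= size (ws i)) -> l <= size (simulate v ws j).
Proof.
elim: j l => [|j IH] l jk; first by exists l.
have [m0 h0] := approximates_large phiU_monotone (phiU_approximates (run jk)) l.
have [a1 h1] := IH m0.*2 (ltnW jk).
exists (maxn a1 m0) => v ws iv iw sv sw.
have ij := simulate_initial iv iw (ltnW jk).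
have := initial_interleave (initial_evens_word ij) (iw j jk).
rewrite [simulate _ _ j.+1]/= -/(simulate v ws j) => ->; apply: h0.
rewrite size_mkseq -addnn; apply: leq_trans (leq_addr _ _); rewrite leq_min size_mkseq.
rewrite geq_half_double h1 //=.
- by apply: leq_trans (sw j jk); exact: leq_maxr.
- by apply: leq_trans sv; exact: leq_maxl.
- by move=> i ik; apply: leq_trans (sw i ik); exact: leq_maxl.
Qed.

End Simulation.

Definition word_of (z : word) (i : nat) : word := CodeSeq.decode (nth 0 z i).

(* On every extension of v, a run whose answers extend the words in z stops
   successfully after exactly size z steps. *)
Definition forces (v z : word) : bool :=
  [&& size z <= find (fun j => nth 0 (simulate v (word_of z) j) 0 == 0)
        (mkseq id (size z)),
      1 <= size (simulate v (word_of z) (size z)) &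
      nth 0 (simulate v (word_of z) (size z)) 0 == 0].

(** The default of [nth] is 0, so a nonzero first digit is automatically a known one. Only the final
    zero needs the condition that the word is nonempty. *)
Lemma forcesP v z : forces v z <->
  [/\ forall j, j < size z -> nth 0 (simulate v (word_of z) j) 0 <> 0,
      0 < size (simulate v (word_of z) (size z)) &
      nth 0 (simulate v (word_of z) (size z)) 0 = 0].
Proof.
split=> [/and3P[h1 h2 /eqP h3]|[h1 h2 h3]]; last first.
  apply/and3P; split=> //; last exact/eqP.
  rewrite leqNgt; apply/negP => lt.
  have lt' := lt; rewrite -[ltnRHS](size_mkseq id) -has_find in lt'.
  by have := nth_find 0 lt'; rewrite nth_mkseq // => /eqP; exact: h1.
split=> // j jz; have := before_find 0 (leq_trans jz h1).
by rewrite nth_mkseq // => /eqP.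
Qed.

Lemma rec_forces : rec2 forces.
Proof. by rewrite /rec2 /forces /simulate /word_of; rec_tac. Qed.
#[local] Hint Resolve rec_forces : rec.

Definition winning (q : baire) (n : nat) : bool :=
  forces (mkseq q (nfst n)) (CodeSeq.decode (nsnd n)).

(** Taking the least witness makes the script unique; its code is returned as a constant
    sequence. *)
Definition search : mvf baire baire := fun q => [set s | exists n,
  [/\ winning q n, forall m, m < n -> ~~ winning q m & s = fun _ => nsnd n]].

Lemma leq_nfst n : nfst n <= n.
Proof. by rewrite -[leqRHS]npair_surj leq_npair1. Qed.

Lemma computable_search : computable search.
Proof.
pose P w n := forces (take (nfst n) w) (CodeSeq.decode (nsnd n)).
apply: (@computable_digits _
   (fun w (_ : nat) => (find (P w) (mkseq id (size w))).+1 <= size w)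
   (fun w (_ : nat) => nsnd (find (P w) (mkseq id (size w))))).
- by rewrite /rec2 /P; rec_tac.
- by rewrite /rec2 /P; rec_tac.
move=> p _ [n [wn nmin ->]].
(* Since [nfst i <= i < m], the first [m] digits contain the prefix that candidate [i] asks for. *)
have PE m i : i < m -> P (mkseq p m) i = winning p i.
  by move=> im; rewrite /P take_mkseq // (leq_trans (leq_nfst i)) // ltnW.
split=> [m _|_].
  rewrite size_mkseq => lt; congr nsnd; set k := find _ _ in lt *.
  have lt' : has (P (mkseq p m)) (mkseq id m) by rewrite has_find size_mkseq.
  have wk : winning p k by rewrite -(PE m) //; have := nth_find 0 lt'; rewrite nth_mkseq.
  case: (ltngtP k n) => // h; first by have := nmin _ h; rewrite wk.
  by have := before_find 0 h; rewrite nth_mkseq ?PE ?wn //; exact: ltn_trans lt.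
exists n.+1 => m nm; rewrite size_mkseq -[ltnRHS](size_mkseq id) -has_find.
apply/hasP; exists n; last by rewrite PE.
by rewrite /mkseq map_id mem_iota.
Qed.

Definition overwrite (w : word) (t : baire) : baire :=
  fun n => if n.+1 <= size w then nth 0 w n else t n.

Lemma initial_overwrite w t : initial w (overwrite w t).
Proof. by apply/initialP => i iw; rewrite /overwrite iw. Qed.

(** A true successful run yields a script: by continuity there is one length [a] such that the first
    [a] digits of the start and of each answer determine the first digits of all states. *)
Lemma winning_exists F q : mdom (diamond F) q -> exists n, winning q n.
Proof.
move=> [_ [_ [u [k [<- [run uk0 nz] _]]]]].
have /choice[t tP] i : exists t, i < k -> U (bpair (evens (u i)) t) (u i.+1).
  have [ik|] := boolP (i < k); last by exists (fun _ => 0).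
  by have /LE[_ [t _ Pt]] := run i ik; exists t => _; apply/U_bpair.
have [a aP] : exists a, forall v ws, initial v (u 0) ->
    (forall i, i < k -> initial (ws i) (t i)) -> a <= size v ->
    (forall i, i < k -> a <= size (ws i)) ->
    forall j, j < k.+1 -> 0 < size (simulate v ws j).
  suff h n : n <= k.+1 -> exists a, forall v ws, initial v (u 0) ->
    (forall i, i < k -> initial (ws i) (t i)) -> a <= size v ->
    (forall i, i < k -> a <= size (ws i)) ->
    forall j, j < n -> 0 < size (simulate v ws j) by exact: h (leqnn _).
  elim: n => [|n IH] nk; first by exists 0.
  have [a1 h1] := IH (ltnW nk); have [a2 h2] := simulate_large tP 1 nk.
  exists (maxn a1 a2) => v ws iv iw sv sw j; rewrite ltnS leq_eqVlt => /predU1P[->|jn].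
    apply: h2 => //; first by apply: leq_trans sv; exact: leq_maxr.
    by move=> i ik; apply: leq_trans (sw i ik); exact: leq_maxr.
  apply: h1 => //; first by apply: leq_trans sv; exact: leq_maxl.
  by move=> i ik; apply: leq_trans (sw i ik); exact: leq_maxl.
pose z := mkseq (fun i => CodeSeq.code (mkseq (t i) a)) k.
have zE i : i < k -> word_of z i = mkseq (t i) a.
  by move=> ik; rewrite /word_of nth_mkseq // CodeSeq.codeK.
have iz i : i < k -> initial (word_of z i) (t i).
  by move=> ik; rewrite zE //; exact: initial_mkseq.
have sz i : i < k -> a <= size (word_of z i) by move=> ik; rewrite zE // size_mkseq.
have hsz j : j <= k -> 0 < size (simulate (mkseq (u 0) a) (word_of z) j).
  move=> jk; apply: aP => //; first exact: initial_mkseq.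
  by rewrite size_mkseq.
have hin j : j <= k -> nth 0 (simulate (mkseq (u 0) a) (word_of z) j) 0 = u j 0.
  move=> jk; apply: initial_app (hsz j jk).
  exact: (simulate_initial tP (initial_mkseq _ _) iz).
exists (npair a (CodeSeq.code z)); rewrite /winning npairK1 npairK2 CodeSeq.codeK.
apply/forcesP; rewrite size_mkseq; split=> [j jk||].
- by rewrite hin ?(ltnW jk) //; exact: nz.
- exact: hsz.
- by rewrite hin.
Qed.

(* A state is <<Q, A>, (i, j) :: y>: the instances Q, the scripts A found by the
   search, and the state y after j steps of the i-th instance.  After the last
   step, one idle query to 0 is made, so that the result appears as y. *)
Definition sched_i (x : baire) : nat := nfst (odds x 0).
Definition sched_j (x : baire) : nat := nsnd (odds x 0).
Definition script (x : baire) : word :=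
  CodeSeq.decode (odds (evens x) (npair (nfst (odds x 0)) 0)).
Definition active (x : baire) : bool := (nsnd (odds x 0)).+1 <= size (script x).

(** While a script is active, the answer is corrected by the scripted word before the program of [y]
    sees it. In the idle step the program is one that returns the next instance as the new [y]. *)
Definition seq_pre (s : baire) : baire :=
  bpair (fun n => if active (evens s) then evens (stl (odds (evens s))) n
           else constant_name (col (evens (evens (evens s))) (sched_i (evens s)).+1) n)
        (fun n => if active (evens s)
           then overwrite (word_of (script (evens s)) (sched_j (evens s))) (odds s) n
           else odds s n).
Definition next_state (s : baire) : baire :=
  bpair (evens (evens (evens s))) (scons (if active (evens (evens s))
     then npair (sched_i (evens (evens s))) (sched_j (evens (evens s))).+1
     else npair (sched_i (evens (evens s))).+1 0) (odds s)).
Definition query (x : baire) : baire :=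
  fun n => if active x then odds (stl (odds x)) n else 0.
Definition seq_post (s : baire) : baire := bpair (next_state s) (query (next_state s)).

Lemma computable_fun_seq_pre : computable_fun seq_pre.
Proof.
apply: computable_fun_orec.
by rewrite /seq_pre /active /script /sched_i /sched_j /constant_name /overwrite
  /word_of; orec_tac.
Qed.
Lemma computable_fun_query : computable_fun query.
Proof. by apply: computable_fun_orec; rewrite /query /active /script; orec_tac. Qed.
Lemma computable_fun_seq_post : computable_fun seq_post.
Proof.
have cn : computable_fun next_state.
  by apply: computable_fun_orec; rewrite /next_state /active /script /sched_i /sched_j;
    orec_tac.
by apply: (computable_fun_bpair cn); exact: computable_fun_comp computable_fun_query cn.
Qed.

(** A script of length k costs k + 1 steps, the additional one being the idle query. *)
Definition start_time (u : word) : nat :=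
  iteri (size u) (fun i z => z + (size (word_of u i)).+1) 0.
Lemma rec_start_time : rec start_time.
Proof. by rewrite /start_time /word_of; rec_tac. Qed.
#[local] Hint Resolve rec_start_time : rec.

Definition start_index (A : baire) (i : nat) : nat :=
  start_time (mkseq (fun l => A (npair l 0)) i).

Lemma start_indexS A i :
  start_index A i.+1 = start_index A i + (size (CodeSeq.decode (A (npair i 0)))).+1.
Proof.
have h k : k <= i.+1 -> iteri k (fun l z => z + (size (word_of (mkseq (fun l =>
  A (npair l 0)) i.+1) l)).+1) 0
   = iteri k (fun l z => z + (size (CodeSeq.decode (A (npair l 0)))).+1) 0.
  by elim: k => // k IH ki /=; rewrite IH ?(ltnW ki) // /word_of nth_mkseq.
have h' k : k <= i -> iteri k (fun l z => z + (size (word_of (mkseq (fun l =>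
  A (npair l 0)) i) l)).+1) 0
   = iteri k (fun l z => z + (size (CodeSeq.decode (A (npair l 0)))).+1) 0.
  by elim: k => // k IH ki /=; rewrite IH ?(ltnW ki) // /word_of nth_mkseq.
by rewrite /start_index /start_time !size_mkseq h // h'.
Qed.

Lemma start_index_mono A i i' : i <= i' -> start_index A i <= start_index A i'.
Proof.
elim: i' => [|i' IH]; first by rewrite leqn0 => /eqP ->.
rewrite leq_eqVlt => /predU1P[->//|/IH]; rewrite start_indexS => /leq_trans; apply.
exact: leq_addr.
Qed.

(** Including its idle step, instance [i] occupies exactly the steps between two consecutive values
    of [start_index], so these intervals are disjoint. This lets a step number identify the instance
    it belongs to. *)
Lemma schedule_uniq A i j i' j' :
  j <= size (CodeSeq.decode (A (npair i 0))) ->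
  j' <= size (CodeSeq.decode (A (npair i' 0))) ->
  start_index A i + j = start_index A i' + j' -> i = i' /\ j = j'.
Proof.
wlog ii' : i j i' j' / i <= i'.
  move=> h ji ji' e; case/orP: (leq_total i i') => [le|le]; first exact: h.
  by have [] := h _ _ _ _ le ji' ji (esym e).
move: ii'; rewrite leq_eqVlt => /predU1P[-> _ _ /addnI //|lt ji ji' e].
have := start_index_mono A lt; rewrite start_indexS => le.
have : start_index A i + j < start_index A i'.
  by apply: leq_trans le; rewrite -addnS leq_add2l ltnS.
by rewrite e ltnNge leq_addr.
Qed.

(** Domains and values must be treated together: the invariant at level [m] makes every query
    answerable and every program convergent on all answers, which is the domain condition of the
    next composition. *)
Lemma stage_invariant f p (inv : nat -> baire -> Prop) : inv 0 p ->
  (forall m z, inv m z -> mdom f (odds z) /\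
     forall t, f (odds z) t -> exists2 z', Phi (evens z) t z' & inv m.+1 z') ->
  forall m, mdom (stage f m) p /\ forall z, stage f m p z -> inv m z.
Proof.
move=> i0 istep; elim=> [|m [[z0 pz0] IH]].
  by split; [exists p | move=> _ ->].
have sub : stage f m p `<=` mdom (id_times f).
  by move=> z /IH/istep[d _]; apply/mdom_id_times.
have ans r : iterate f m.+1 p r ->
  exists2 z, inv m z & evens r = evens z /\ f (odds z) (odds r).
  by rewrite iterateS => -[_ [z /IH iz /id_timesE h]]; exists z.
split.
  have [r zr] := sub _ pz0.
  have ir : iterate f m.+1 p r by rewrite iterateS; split=> //; exists z0.
  have sub' : iterate f m.+1 p `<=` mdom U.
    move=> s /ans[z /istep[_ h] [e fs]]; have [z' Pz' _] := h _ fs.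
    by exists z'; apply/UE; rewrite e.
  by have [z' Uz'] := sub' r ir; exists z'; split=> //; exists r.
move=> z' [_ [r /ans[z /istep[_ h] [e fs]] /UE Pz']].
have [z'' Pz'' iz''] := h _ fs.
by rewrite e in Pz'; rewrite (Phi_single_valued Pz' Pz'').
Qed.

Lemma stage_invariant_iterate f p (inv : nat -> baire -> Prop) : inv 0 p ->
  (forall m z, inv m z -> mdom f (odds z) /\
     forall t, f (odds z) t -> exists2 z', Phi (evens z) t z' & inv m.+1 z') ->
  (forall n, mdom (iterate f n) p) /\
  forall m r, iterate f m.+1 p r -> exists2 z, inv m z & evens r = evens z.
Proof.
move=> i0 istep; have h := stage_invariant i0 istep; split=> [[|m]|m r].
- by exists p.
- have [[z pz] hm] := h m; rewrite iterateS.
  have [[t ft] _] := istep _ _ (hm _ pz).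
  exists (bpair (evens z) t); split.
    by move=> z' /hm/istep[d _]; apply/mdom_id_times.
  by exists z => //; apply/id_timesE; rewrite evens_bpair odds_bpair.
- by rewrite iterateS => -[_ [z /(proj2 (h m)) iz /id_timesE[e _]]]; exists z.
Qed.

Section DiamondBelowOmega.
Variable F : mvf baire baire.
Hypothesis F_overwrite : forall s t w, F s t -> F s (overwrite w t).
Hypothesis F_zero : mdom F (fun _ => 0).

Variable N : baire -> baire.
Hypothesis N_state : forall x, state_of (N x) = x.
Hypothesis N_step : forall x t y, U (seq_pre (bpair x t)) y ->
  let z := seq_post (bpair (bpair x t) y) in
  Phi (N x) t (bpair (N (evens z)) (odds z)).

Variables Q A : baire.
Hypothesis Q_dom : forall i, diamond_dom F (col Q i).
Hypothesis A_search : forall i, search (col Q i) (col A i).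

Let scr i : word := CodeSeq.decode (A (npair i 0)).

Lemma scr_winning i : exists n, winning (col Q i) n /\ scr i = CodeSeq.decode (nsnd n).
Proof.
have [n [wn _ e]] := A_search i; exists n; split=> //.
by rewrite /scr -[A _]/(col A i 0) e.
Qed.

Definition guided_run i j (q t : nat -> baire) : Prop :=
  q 0 = col Q i /\ forall l, l < j ->
  [/\ L F (q l) (q l.+1), F (odds (q l)) (t l), initial (word_of (scr i) l) (t l) &
      Phi (evens (q l)) (t l) (q l.+1)].

Definition guided i j y := exists q t, guided_run i j q t /\ q j = y.

(** The answers extend the words of a winning script, so the simulated words are prefixes of the
    true states and pass their first digits on to them. *)
Lemma guided_run_digits i j q t : guided_run i j q t -> j <= size (scr i) ->
  (forall l, l < size (scr i) -> l <= j -> q l 0 <> 0) /\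
  (j = size (scr i) -> q j 0 = 0).
Proof.
move=> [q0 run] js; have [n [/forcesP]] := scr_winning i.
move=> + e; rewrite -e => -[h1 h2 h3].
have U_run l : l < j -> U (bpair (evens (q l)) (t l)) (q l.+1).
  by move=> /run[_ _ _ h]; apply/U_bpair.
have iq l : l <= j -> initial (simulate (mkseq (col Q i) (nfst n)) (word_of (scr i)) l)
  (q l).
  apply: (simulate_initial U_run); first by rewrite q0; exact: initial_mkseq.
  by move=> l' /run[].
split=> [l ls lj|ej].
  have nz := h1 l ls; move/initialP: (iq l lj) => /(_ 0) <- //.
  by case: (simulate _ _ _) nz.
by have := iq j (leqnn j); rewrite {1}ej => /initialP/(_ 0 h2) <-.
Qed.

(** Before the end of the script all first digits are nonzero, so a state without successor would
    make the run stall, which [Q_dom] forbids. *)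
Lemma guided_dom i j y : guided i j y -> j < size (scr i) -> mdom (L F) y.
Proof.
move=> [q [t [gr <-]]] js; apply: contrapT => nd.
have [/(_ j) h _] := Q_dom (proj1 gr); apply: h; split=> //.
- by move=> l /(proj2 gr)[].
- move=> l lj; have [h _] := guided_run_digits gr (ltnW js).
  by apply: h => //; exact: leq_ltn_trans lj js.
Qed.

(** By [F_overwrite] the corrected answer is itself an admissible answer, so the simulation remains
    a genuine run. *)
Lemma guided_step i j y t y' : guided i j y -> j < size (scr i) ->
  F (odds y) t -> Phi (evens y) (overwrite (word_of (scr i) j) t) y' -> guided i j.+1 y'.
Proof.
move=> gy js ft Py'.
have /mdom_LE[_ dy] := guided_dom gy js.
have [q [u [[q0 run] qj]]] := gy.
exists (fun l => if l <= j then q l else y').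
exists (fun l => if l < j then u l else overwrite (word_of (scr i) j) t).
split; last by rewrite ltnn.
split=> // l; rewrite ltnS => lj0.
have /predU1P[->|lj] : (l == j) || (l < j) by rewrite -leq_eqVlt.
2: {
  by rewrite /= lj (ltnW lj); exact: run. }
rewrite /= leqnn ltnn qj; split=> //.
- by apply/LE; split=> //; exists (overwrite (word_of (scr i) j) t) => //;
  exact: F_overwrite.
- exact: F_overwrite.
- exact: initial_overwrite.
Qed.

Lemma guided_diamond i y : guided i (size (scr i)) y -> diamond F (col Q i) y.
Proof.
move=> [q [t [gr <-]]]; split; first exact: Q_dom.
have [h1 h2] := guided_run_digits gr (leqnn _).
exists q, (size (scr i)); split=> //; first exact: (proj1 gr).
split; first by move=> l /(proj2 gr)[].
- exact: h2.
- by move=> l ls; apply: h1 => //; exact: ltnW.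
Qed.

Definition seq_state i j y := bpair (bpair Q A) (scons (npair i j) y).

Lemma seq_stateE i j y (x := seq_state i j y) :
  [/\ sched_i x = i, sched_j x = j, script x = scr i, stl (odds x) = y &
      evens x = bpair Q A].
Proof.
rewrite /sched_i /sched_j /script /x /seq_state !(evens_bpair, odds_bpair) stl_scons.
by rewrite /scons /= npairK1 npairK2.
Qed.

Lemma seq_active i j y : active (seq_state i j y) = (j < size (scr i)).
Proof.
rewrite /active; have [_ sj -> _ _] := seq_stateE i j y.
by rewrite -[nsnd _]/(sched_j _) sj.
Qed.

Definition schedule_inv (m : nat) (z : baire) : Prop := exists i j y,
  [/\ m = start_index A i + j, j <= size (scr i), guided i j y &
      z = bpair (N (seq_state i j y)) (query (seq_state i j y))].

Lemma schedule_inv0 :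
  schedule_inv 0 (bpair (N (seq_state 0 0 (col Q 0))) (query (seq_state 0 0 (col Q 0)))).
Proof.
exists 0, 0, (col Q 0); split=> //.
by exists (fun _ => col Q 0), (fun _ => col Q 0).
Qed.

Lemma schedule_invS m z : schedule_inv m z -> mdom F (odds z) /\
  forall t, F (odds z) t -> exists2 z', Phi (evens z) t z' & schedule_inv m.+1 z'.
Proof.
move=> [i [j [y [em js gy ->]]]]; rewrite evens_bpair odds_bpair.
have [si sj sc sy se] := seq_stateE i j y; have act := seq_active i j y.
have qE : query (seq_state i j y) = if j < size (scr i) then odds y else (fun _ => 0).
  by apply/funext => n; rewrite /query act sy; case: ifP.
have postE t y' : seq_post (bpair (bpair (seq_state i j y) t) y') =
    let x' := if j < size (scr i) then seq_state i j.+1 y' else seq_state i.+1 0 y' in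
    bpair x' (query x').
  rewrite /seq_post (_ : next_state _ = if j < size (scr i) then seq_state i j.+1 y'
    else seq_state i.+1 0 y') //.
  by rewrite /next_state !(evens_bpair, odds_bpair) act si sj ?se /seq_state; case: ifP.
have preE t : seq_pre (bpair (seq_state i j y) t) =
    if j < size (scr i) then bpair (evens y) (overwrite (word_of (scr i) j) t)
    else bpair (constant_name (col Q i.+1)) t.
  by rewrite /seq_pre !(evens_bpair, odds_bpair) act si sj sc ?sy ?se ?evens_bpair;
    case: ifP.
rewrite qE; case: ltnP js => [jlt _|jge js].
  have /mdom_LE[dy ans] := guided_dom gy jlt; split=> // t ft.
  have [y' Py'] := ans _ (F_overwrite (word_of (scr i) j) ft).
  have := @N_step (seq_state i j y) t y';
    rewrite preE postE jlt => /(_ (proj2 (U_bpair _ _ _) Py')).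
  rewrite /= !(evens_bpair, odds_bpair) => h; eexists; first exact: h.
  exists i, j.+1, y'; split=> //; first by rewrite em addnS.
  exact: guided_step Py'.
(* The idle step: [F_zero] makes the query 0 answerable, the answer is discarded, and instance
   [i.+1] begins. *)
split=> // t _; have ej : j = size (scr i) by apply/eqP; rewrite eqn_leq js.
have := @N_step (seq_state i j y) t (col Q i.+1).
rewrite preE postE ltnNge jge => /(_ (proj2 (U_bpair _ _ _) (Phi_constant_name _ _))).
rewrite /= !(evens_bpair, odds_bpair) => h; eexists; first exact: h.
exists i.+1, 0, (col Q i.+1); split=> //.
  by rewrite em start_indexS addn0 addnS ej.
by exists (fun _ => col Q i.+1), (fun _ => col Q i.+1).
Qed.

Lemma schedule_inv_result i z : schedule_inv (start_index A i + size (scr i)) z ->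
  exists2 y, diamond F (col Q i) y & stl (odds (state_of (evens z))) = y.
Proof.
move=> [i' [j' [y [e js gy ->]]]].
have [ei ej] := schedule_uniq (leqnn _) js e.
exists y; first by apply: guided_diamond; rewrite ei; move: gy; rewrite -ej -ei.
by rewrite evens_bpair N_state; have [_ _ _ ->] := seq_stateE i' j' y.
Qed.

End DiamondBelowOmega.

Lemma diamond_le_omega (f : problem) (F := realizer_version f) :
  (forall s t w, F s t -> F s (overwrite w t)) -> mdom F (fun _ => 0) ->
  lesW (parallelization (diamond_problem f)) (omega_problem f).
Proof.
move=> F_overwrite F_zero.
have [N [cN _ NK NS]] := machine computable_fun_seq_pre computable_fun_seq_post.
pose x0 (s : baire) := bpair s (scons (npair 0 0) (col (evens s) 0)).
pose K0 s := bpair (N (x0 s)) (query (x0 s)).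
(* Component 0 of a value of omega is the input itself, whose program carries the scripts. *)
pose scripts (r : baire) := odds (evens (state_of (evens (col r 0)))).
(* Component [m.+1] shows the program of stage [m]. The result of instance [i] is present at its
   idle step, one before [start_index] of [i.+1], and is thus read at that very index. *)
pose H (r : baire) := tuple_of (fun i =>
  stl (odds (state_of (evens (col r (start_index (scripts r) i.+1)))))).
have cx0 : computable_fun x0 by apply: computable_fun_orec; rewrite /x0; orec_tac.
have cK0 : computable_fun K0.
  apply: computable_fun_bpair; [exact: computable_fun_comp cN cx0 | exact:
    computable_fun_comp computable_fun_query cx0].
have cK := computable_comp (computable_juxt computable_fun_id (computable_parallel
  computable_search)) cK0.
have cH : computable_fun H.
  by apply: computable_fun_orec; rewrite /H /scripts /start_index /state_of
    /show_digits; orec_tac.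
apply: (lesWI cH cK) => Q [yQ] /(@mcomp_parallelization (diamond F)) dQ.
have domQ i : diamond_dom F (col Q i).
  by rewrite -mdom_diamond; exists (yQ i).
have /choice[a aP] i : exists a, search (col Q i) a.
  have /winning_exists ex : mdom (diamond F) (col Q i) by exists (yQ i).
  case: (ex_minnP ex) => n wn nmin; exists (fun _ => nsnd n); exists n; split=> //.
  by move=> m mn; apply/negP => /nmin; rewrite leqNgt mn.
pose A := tuple_of a.
have AP i : search (col Q i) (col A i) by rewrite col_tuple.
exists (K0 (bpair Q A)).
  by exists (bpair Q A) => //; exists Q, A; split.
have K0E : K0 (bpair Q A) = bpair (N (seq_state Q A 0 0 (col Q 0)))
    (query (seq_state Q A 0 0 (col Q 0))).
  by rewrite /K0 /x0 evens_bpair.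
have [di dv] := stage_invariant_iterate (schedule_inv0 F N Q A)
   (schedule_invS F_overwrite F_zero NS domQ AP).
rewrite K0E /= mcomp_mid; split.
  by rewrite -[mdom _ _]/(mdom (omega F) _) mdom_omega.
move=> r _ -> [r' r'P er]; exists (col (H r)); first exact/delta_seq_baire.
apply/(@mcomp_parallelization (diamond F)) => i.
have rP n : iterate F n (bpair (N (seq_state Q A 0 0 (col Q 0)))
    (query (seq_state Q A 0 0 (col Q 0)))) (col r n).
  by rewrite er col_tuple.
have sr : scripts r = A.
  have := rP 0; rewrite /scripts => ->; rewrite evens_bpair NK.
  by have [_ _ _ _ ->] := seq_stateE Q A 0 0 (col Q 0); rewrite odds_bpair.
rewrite /H col_tuple sr start_indexS addnS.
have [z iz ->] := dv _ _ (rP (start_index A i + size (CodeSeq.decode (A (npair i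
  0)))).+1).
by have [y hy ->] := schedule_inv_result NK domQ AP iz.
Qed.

(** * Forcing and the existence of descending sequences *)

(** Only countability is wanted: finite trees serve as codes for all recursive functions, and
    minimization is interpreted by choice. *)
Fixpoint interp (c : GenTree.tree nat) : nat -> nat :=
  match c with
  | GenTree.Leaf 0 => fun _ => 0
  | GenTree.Leaf 1 => S
  | GenTree.Leaf 2 => nfst
  | GenTree.Leaf _ => nsnd
  | GenTree.Node 0 [:: f; g] => fun n => npair (interp f n) (interp g n)
  | GenTree.Node 1 [:: f; g] => fun n => interp f (interp g n)
  | GenTree.Node 2 [:: f; g] => fun n =>
      iteri (nsnd n) (fun y z => interp g (npair (nfst n) (npair y z))) (interp f (nfst
        n))
  | GenTree.Node _ [:: f] => fun a =>
      xget 0 [set m | interp f (npair a m) = 0 /\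
                      forall k, k < m -> interp f (npair a k) <> 0]
  | _ => fun _ => 0
  end.

Lemma interp_surj f : recursive f -> exists c, interp c = f.
Proof.
elim=> [||||{}f g _ [c <-] _ [c' <-]|{}f g _ [c <-] _ [c' <-]|{}f g _ [c <-] _ [c'
  <-]|{}f h _ [c <-] hP].
- by exists (GenTree.Leaf 0).
- by exists (GenTree.Leaf 1).
- by exists (GenTree.Leaf 2).
- by exists (GenTree.Leaf 3).
- by exists (GenTree.Node 0 [:: c; c']).
- by exists (GenTree.Node 1 [:: c; c']).
- by exists (GenTree.Node 2 [:: c; c']).
exists (GenTree.Node 3 [:: c]); apply/funext => a /=.
have [h0 hmin] := hP a.
case: xgetP => [m _ [m0 mmin]|/(_ (h a))[] //].
by case: (ltngtP m (h a)) => // [/hmin|/mmin].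
Qed.

(** An enumeration that contains all recursive word functions. A code may minimize a function that
    is not regular, so recursiveness of [functional e] is stated separately where it is used. *)
Definition functional (e : nat) (w : word) : word :=
  CodeSeq.decode ((if unpickle e is Some c then interp c else id) (CodeSeq.code w)).

Lemma functional_surj phi : rec phi -> exists e, functional e = phi.
Proof.
move=> [g /interp_surj[c <-] h]; exists (pickle c); apply/funext => w.
by rewrite /functional pickleK [interp c _](h w) CodeSeq.codeK.
Qed.

Lemma turing_le_functional q p : turing_le q p -> exists e,
  rec (functional e) /\ approximates (functional e) p q.
Proof.
move=> [F /computableE[phi [_ rphi h]] /h ap].
by have [e eE] := functional_surj rphi; exists e; rewrite eE.
Qed.

(* Baire category in a product of discrete spaces. *)
Lemma fusion (S : Type) (B : nat -> set S) (D : nat -> set (nat -> S)) rho0 :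
  (forall i, B i (rho0 i)) ->
  (forall k n rho, (forall i, B i (rho i)) -> exists rho' n',
     [/\ forall i, B i (rho' i), forall i, i < n -> rho' i = rho i &
         forall rho'', (forall i, B i (rho'' i)) ->
           (forall i, i < n' -> rho'' i = rho' i) -> D k rho'']) ->
  exists rho, (forall i, B i (rho i)) /\ forall k, D k rho.
Proof.
move=> B0 step.
have /choice[nxt nxtP] (x : nat * (nat * (nat -> S))) : exists y : (nat -> S) * nat,
    (forall i, B i (x.2.2 i)) -> [/\ forall i, B i (y.1 i),
      forall i, i < x.2.1 -> y.1 i = x.2.2 i &
      forall rho'', (forall i, B i (rho'' i)) ->
        (forall i, i < y.2 -> rho'' i = y.1 i) -> D x.1 rho''].
  case: x => k [n rho] /=; have [Bx|nB] := pselect (forall i, B i (rho i)).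
    by have [rho' [n' h]] := step k n rho Bx; exists (rho', n').
  by exists (rho, n) => /nB.
(* The bound grows strictly, so entry [i] is settled after [i.+1] steps and the diagonal is the
   limit. *)
pose s n := iteri n (fun k st =>
  ((nxt (k, (st.2, st.1))).1, maxn (nxt (k, (st.2, st.1))).2 st.2.+1)) (rho0, 0).
have sB k : forall i, B i ((s k).1 i).
  by elim: k => // k IH; have [] := nxtP (k, ((s k).2, (s k).1)) IH.
have s_step k i : i < (s k).2 -> (s k.+1).1 i = (s k).1 i.
  by have [_ h _] := nxtP (k, ((s k).2, (s k).1)) (sB k); exact: h.
have s_bound k : k <= (s k).2.
  by elim: k => // k IH; rewrite leq_max ltnS IH orbT.
have s_mono k l : k <= l -> (s k).2 <= (s l).2.
  elim: l => [|l IH]; first by rewrite leqn0 => /eqP ->.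
  rewrite leq_eqVlt => /predU1P[->//|/IH] /leq_trans; apply.
  by rewrite leq_max leqnSn orbT.
have s_agree k l i : k <= l -> i < (s k).2 -> (s l).1 i = (s k).1 i.
  elim: l => [|l IH]; first by rewrite leqn0 => /eqP ->.
  rewrite leq_eqVlt => /predU1P[->//|kl] ik.
  by rewrite s_step ?IH // (leq_trans ik) // s_mono.
exists (fun i => (s i.+1).1 i); split=> [i|k]; first exact: sB.
have [_ _ h] := nxtP (k, ((s k).2, (s k).1)) (sB k).
apply: h => [i|i ik]; first exact: sB.
have ik' : i < (s k.+1).2 by rewrite leq_max ik.
rewrite -[(nxt _).1]/((s k.+1).1).
case/orP: (leq_total k i) => [ki|ki]; first exact: s_agree.
by rewrite -(@s_agree i.+1 k.+1) // s_bound.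
Qed.

Definition tail_columns (n : nat) (X : baire) : baire :=
  fun l => X (npair (nfst l + n) (nsnd l)).

Lemma computable_fun_tail_columns n : computable_fun (tail_columns n).
Proof. by apply: computable_fun_orec; rewrite /tail_columns; orec_tac. Qed.

Lemma tail_columnsD m n X : tail_columns m (tail_columns n X) = tail_columns (m + n) X.
Proof. by apply/funext => l; rewrite /tail_columns npairK1 npairK2 addnA. Qed.

Lemma continuity_bound (idx : nat -> nat) m : exists b, forall X Y : baire,
  (forall i, i < b -> X i = Y i) ->
    mkseq (fun l => X (idx l)) m = mkseq (fun l => Y (idx l)) m.
Proof.
elim: m => [|m [b IH]]; first by exists 0.
exists (maxn b (idx m).+1) => X Y XY;
  rewrite !mkseqS (IH X Y) ?XY ?leq_max ?ltnSn ?orbT //.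
by move=> i ib; apply: XY; rewrite leq_max ib.
Qed.

(** A finite extension argument: whenever some extension lets the functional converge on the tail,
    one digit of column [n], which the tail does not see, is set against the computed value. *)
Lemma independent_columns : exists X : baire, forall n e,
  ~ approximates (functional e) (tail_columns n.+1 X) (col X n).
Proof.
pose D k (X : baire) :=
  ~ approximates (functional (nsnd k)) (tail_columns (nfst k).+1 X) (col X (nfst k)).
have [||X [_ XD]] := @fusion nat (fun _ => setT) D (fun _ => 0).
- by [].
- move=> k N rho _; rewrite /D; move: (nfst k) (nsnd k) => n e.
  pose agree (X : baire) := forall i, i < N -> X i = rho i.
  have [[X [agX [r ap]]]|nex] := pselect (exists X, agree X /\
      exists r, approximates (functional e) (tail_columns n.+1 X) r); last first.
    exists rho, N; split=> // X _ agX ap; apply: nex; exists X; split=> //.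
    by exists (col X n).
  (* The position [npair n N] is at least [N], hence outside the part already fixed, and lies in
     column [n], whereas the tail starts with column [n.+1]. *)
  pose X' : baire := fun l => if l == npair n N then (r N).+1 else X l.
  have tX' : tail_columns n.+1 X' = tail_columns n.+1 X.
    apply/funext => l; rewrite /tail_columns /X'; case: eqP => // /(congr1 nfst).
    by rewrite !npairK1 => /eqP; rewrite addnS eqn_leq ltnNge leq_addl.
  have [m hm] := proj2 ap N.+1.
  have [b hb] := continuity_bound (fun l => npair (nfst l + n.+1) (nsnd l)) m.
  exists X', (maxn b (npair n N).+1); split=> // [i iN|Y _ agY [apY _]].
    rewrite /X' ifN ?agX //; apply: contraTneq iN => ->.
    by rewrite -leqNgt leq_npair2.
  have e1 : mkseq (tail_columns n.+1 Y) m = mkseq (tail_columns n.+1 X) m.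
    by rewrite -tX'; apply: hb => i ib; apply: agY; rewrite leq_max ib.
  have := initial_app (apY m); rewrite e1 => /(_ _ hm).
  rewrite (initial_app (proj1 ap m) hm) /col agY ?leq_max ?ltnSn ?orbT // /X' eqxx.
  by move=> /eqP; rewrite eqn_leq ltnn andbF.
exists X => n e; have := XD (npair n e).
by rewrite /D npairK1 npairK2.
Qed.

(** With [p n] the join of the columns from [n] on, [p n] computes column [n] but [p n.+1] does not.
    All later terms are uniformly computable from [p 1], so their join is no stronger than [p 1]. *)
Lemma descending_exists : exists p : nat -> baire, descending p.
Proof.
have [X XP] := independent_columns.
pose p n := tail_columns n X.
have p_step n : turing_lt (p n.+1) (p n).
  split; first by rewrite /p -add1n -tail_columnsD;
    exact: turing_le_computable_fun (computable_fun_tail_columns 1).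
  move=> le; have : turing_le (col X n) (p n.+1).
    apply: turing_le_trans le.
    have -> : col X n = col (p n) 0 by apply/funext => j;
      rewrite /col /p /tail_columns npairK1 npairK2.
    by apply: (@turing_le_computable_fun (fun s => col s 0));
      apply: computable_fun_orec; orec_tac.
  by move=> /turing_le_functional[e [_ /XP]].
exists p; split=> //.
have le1 : turing_le (tuple_of (fun n => p n.+1)) (p 1).
  have -> : tuple_of (fun n => p n.+1) = tuple_of (fun n => tail_columns n (p 1)).
    by congr tuple_of; apply/funext => n; rewrite /p tail_columnsD addn1.
  apply: (@turing_le_computable_fun (fun s => tuple_of (fun n => tail_columns n s))).
  by apply: computable_fun_orec; rewrite /tail_columns; orec_tac.
split; first exact: turing_le_trans le1 (proj1 (p_step 0)).
by move=> /turing_le_trans/(_ le1); exact: (proj2 (p_step 0)).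
Qed.

Lemma turing_le_columns (t : nat -> baire) c z k :
  (forall i, i < k -> turing_le (t i) z) -> turing_le c z ->
  turing_le (tuple_of (fun i => if i < k then t i else col c i)) z.
Proof.
move=> + cz; elim: k => [|k IH] tz; first by rewrite tuple_col.
pose T (s : baire) : baire := fun n => if nfst n == k then odds s (nsnd n) else evens s n.
have cT : computable_fun T by apply: computable_fun_orec; rewrite /T; orec_tac.
have -> : tuple_of (fun i => if i < k.+1 then t i else col c i) =
    T (bpair (tuple_of (fun i => if i < k then t i else col c i)) (t k)).
  apply/funext => n; rewrite /T evens_bpair odds_bpair /tuple_of ltnS.
  by case: (ltngtP (nfst n) k) => // ->.
apply: turing_le_trans (turing_le_computable_fun _ cT) _; apply: turing_le_bpair;
  last exact: tz.
by apply: IH => i ik; apply: tz; exact: ltnW.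
Qed.

(* Forcing with conditions that fix finitely many entries of the sequence
   completely: by density the finite parts of the other entries are arbitrary,
   so that a functional forced to compute x would do so from z. *)
Lemma avoid_cone (B : nat -> set baire) (x z : baire) :
  (forall n w, exists b, [/\ B n b, initial w b & turing_le b z]) ->
  ~ turing_le x z ->
  exists beta, (forall n, B n (beta n)) /\ ~ turing_le x (tuple_of beta).
Proof.
move=> dense nxz.
pose B' n : set baire := [set b | B n b /\ turing_le b z].
have /choice[rho0 rho0P] n : exists b, B' n b.
  by have [b [Bb _ bz]] := dense n [::]; exists b.
pose D e (rho : nat -> baire) := @rec _ _ coded_word coded_word (functional e) ->
  ~ approximates (functional e) (tuple_of rho) x.
have [|rho [rhoB rhoD]] := @fusion baire B' D _ rho0P; last first.
  exists rho; split=> [n|]; first by have [] := rhoB n.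
  by move=> /turing_le_functional[e [re /(rhoD e re)]].
move=> e n rho rhoB; apply: contrapT => nofuse.
(* If no condition prevents [functional e] from computing [x], then every condition extending [rho]
   has an extension from which [x] is computed. *)
have ex rho' n' : (forall i, B' i (rho' i)) -> (forall i, i < n -> rho' i = rho i) ->
    rec (functional e) /\ exists rho'', [/\ forall i, B' i (rho'' i),
       forall i, i < n' -> rho'' i = rho' i &
       approximates (functional e) (tuple_of rho'') x].
  move=> rho'B rho'n; apply: contrapT => nex; apply: nofuse; exists rho', n'; split=> //.
  by move=> rho'' h1 h2 re ap; apply: nex; split=> //; exists rho''.
have [re _] := ex rho n rhoB (fun _ _ => erefl).
(* The finitely many rows fixed by the condition, padded with zeros: all that is needed as an oracle
   for [x], and still below [z]. *)
pose Z := tuple_of (fun i => if i < n then rho i else col (fun _ => 0) i).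
apply: nxz; apply: (@turing_le_trans Z); last first.
  apply: turing_le_columns; first by move=> i _; have [] := rhoB i.
  by apply: turing_le_rec; rec_tac.
pose match_rows u w := (size u == size w) && (size w <= find (fun l =>
  (nfst l < n) && ~~ (nth 0 u l == nth 0 w l)) (mkseq id (size w))).
have match_rowsP u w : match_rows u w <-> size u = size w /\
    forall l, l < size w -> nfst l < n -> nth 0 u l = nth 0 w l.
  split=> [/andP[/eqP su le]|[su h]].
    split=> // l lw ln; have := before_find 0 (leq_trans lw le).
    by rewrite nth_mkseq // ln /= => /negbFE/eqP.
  apply/andP; split; first exact/eqP.
  rewrite leqNgt; apply/negP => lt.
  have lt' := lt; rewrite -[ltnRHS](size_mkseq id) -has_find in lt'.
  have := nth_find 0 lt'; rewrite nth_mkseq // => /andP[ln].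
  by rewrite h ?eqxx.
(* On a prefix [u] of [Z] this name offers the output of [functional e] on every word that agrees
   with [u] on the fixed rows; the other rows are guessed freely. *)
pose nm (k : nat) := if match_rows (CodeSeq.decode (nfst k)) (CodeSeq.decode (nsnd k))
  then entry (CodeSeq.decode (nfst k)) (functional e (CodeSeq.decode (nsnd k))) else 0.
have rnm : rec nm.
  rewrite /nm /match_rows.
  by rec_tac.
exists (Phi nm); first by apply: computable_Phi rnm _.
have Z_row l : nfst l < n -> Z l = tuple_of rho l by rewrite /Z /tuple_of => ->.
split=> [v [u iu [k]]|m].
  rewrite /nm; case: ifP => // /match_rowsP;
    move: (CodeSeq.decode (nfst k)) (CodeSeq.decode (nsnd k)).
  move=> u' w [su hu]; rewrite -/(entry u v) => eq_entry.
  have := congr1 entry_arg eq_entry; have := congr1 entry_val eq_entry;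
    rewrite !(entry_argK, entry_valK).
  move=> <- eu; rewrite {}eu in su hu.
  (* Soundness of a guess [w]: density extends it to a condition, and an extension of that computing
     [x] shows that the output on [w] is a prefix of [x]. *)
  have /choice[rho' rho'P] i : exists b,
    B' i b /\ (if i < n then b = rho i else initial (col_word w i) b).
    case: (i < n); first by exists (rho i).
    by have [b [Bb ib bz]] := dense i (col_word w i); exists b.
  have iw : initial w (tuple_of rho').
    apply/initialP => l lw; rewrite /tuple_of; have [_] := rho'P (nfst l).
    case: ifP => [ln ->|_ /initialP h].
      by rewrite -hu // -[rho _ _]/(tuple_of rho l) -Z_row //;
        apply: initial_app => //; rewrite su.
    by rewrite -h ?size_col_word ?nth_col_word npair_surj.
  have [||_ [rho'' [_ ag [ap _]]]] := ex rho' (size w).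
  - by move=> i; have [] := rho'P i.
  - by move=> i lt; have [_] := rho'P i; rewrite lt.
  suff -> : w = mkseq (tuple_of rho'') (size w) by exact: ap.
  apply: (@eq_from_nth _ 0) => [|l lw]; first by rewrite size_mkseq.
  rewrite nth_mkseq // (initial_app iw) // /tuple_of ag //.
  by apply: leq_ltn_trans lw; exact: leq_nfst.
have [_ [rho'' [_ ag [_ /(_ m)[k hk]]]]] := ex rho n rhoB (fun _ _ => erefl).
exists (functional e (mkseq (tuple_of rho'') k)) => //.
exists (mkseq Z k); first exact: initial_mkseq.
exists (npair (CodeSeq.code (mkseq Z k)) (CodeSeq.code (mkseq (tuple_of rho'') k))).
rewrite /nm npairK1 npairK2 !CodeSeq.codeK ifT //.
apply/match_rowsP; rewrite !size_mkseq; split=> // l lk ln.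
by rewrite !nth_mkseq // Z_row // /tuple_of ag.
Qed.

(** * The problem on Turing degrees *)

Lemma deg_eq p q : deg p = deg q <-> turing_le p q /\ turing_le q p.
Proof.
split=> [/(congr1 sval)/= e|[pq qp]].
  suff : turing_class q p by [].
  by rewrite -e; split; exact: turing_le_refl.
apply: eq_exist; apply/seteqP; split=> r [h1 h2]; split.
- exact: turing_le_trans h1 pq.
- exact: turing_le_trans qp h2.
- exact: turing_le_trans h1 qp.
- exact: turing_le_trans pq h2.
Qed.

Lemma realizer_version_degrees a s t :
  realizer_version (climb a) s t <-> values (climb a) (deg s) (deg t).
Proof.
split=> [[_ [y [_ [x -> fxy] ty]]]|h]; first by rewrite -ty.
split; last first.
  exists (deg t) => //; split; first by move=> _ ->; exists (deg t).
  by exists (deg s).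
by move=> y _; have [q qy] := degree_delta_surjective y; exists q.
Qed.

Lemma computable_fun_overwrite w : computable_fun (overwrite w).
Proof. by apply: computable_fun_orec; rewrite /overwrite; orec_tac. Qed.

Lemma deg_overwrite w t : deg (overwrite w t) = deg t.
Proof.
apply/deg_eq; split; first exact: turing_le_computable_fun (computable_fun_overwrite w).
have {1}-> : t = overwrite (mkseq t (size w)) (overwrite w t).
  by apply/funext => n; rewrite /overwrite size_mkseq; case: ifP => nw;
    rewrite ?nw ?nth_mkseq.
exact: turing_le_computable_fun (computable_fun_overwrite _).
Qed.

(* From n :: <x, b>, gamma computes the element of iterate f n x that is produced
   by the answers in the columns of b. *)
Definition gamma : mvf baire baire := fun s => [set r | exists zs : nat -> baire,
  [/\ zs 0 = evens (stl s),
      forall i, i < (s 0).-1 -> U (bpair (evens (zs i)) (col (odds (stl s)) i)) (zs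
        i.+1) &
      r = if s 0 == 0 then evens (stl s)
          else bpair (evens (zs (s 0).-1)) (col (odds (stl s)) (s 0).-1)]].

Lemma computable_gamma : computable gamma.
Proof.
pose v w := evens_word (behead w); pose ws w := col_word (odds_word (behead w)).
pose g w := if nth 0 w 0 == 0 then v w
  else interleave (evens_word (simulate (v w) (ws w) (nth 0 w 0).-1)) (ws w (nth 0 w
    0).-1).
apply: (computableI (g := g)).
  by rewrite /g /simulate /v /ws; rec_tac.
move=> s _ [zs [z0 run ->]]; set k := (s 0).-1 in run *.
have bE m : behead (mkseq s m) = mkseq (stl s) m.-1.
  by case: m => // m; rewrite /mkseq /= -[1]addn0 iotaDl -map_comp.
have iv m : initial (v (mkseq s m)) (zs 0).
  by rewrite z0 /v bE; apply: initial_evens_word; exact: initial_mkseq.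
have iw m i : initial (ws (mkseq s m) i) (col (odds (stl s)) i).
  by rewrite /ws bE; apply: initial_col_word; apply: initial_odds_word;
    exact: initial_mkseq.
split=> [[|m]|n].
- by rewrite /g /v.
- rewrite /g [nth _ _ _]/= -/k; case: ifP => _; first by rewrite -z0.
  apply: initial_interleave => //; apply: initial_evens_word.
  exact: (simulate_initial run).
have sv m : n.*2.*2.+1 < m -> n.*2 <= size (v (mkseq s m)).
  by move=> h; rewrite /v bE !size_mkseq geq_half_double -ltnS (ltn_predK h) ltnW.
have [m0 h0] := simulate_large run n.*2 (leqnn k).
have [m1 h1] : exists m1, forall m, m1 <= m -> forall i, i < k.+1 ->
  maxn m0 n <= size (ws (mkseq s m) i).
  elim: (k.+1) => [|j [m1 IH]]; first by exists 0.
  have [m2 h2] := col_word_large j (maxn m0 n).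
  exists (maxn m1 m2.+1.*2.+1) => m; rewrite geq_max => /andP[h h'] i.
  rewrite ltnS leq_eqVlt => /predU1P[->|]; last exact: IH.
  rewrite /ws bE.
  have -> : odds_word (mkseq (stl s) m.-1) = mkseq (odds (stl s)) (m.-1)./2.
    by rewrite [LHS](initial_odds_word (initial_mkseq _ _)) !size_mkseq.
  apply: h2; rewrite geq_half_double -ltnS (ltn_predK h').
  by apply: leq_trans h'; rewrite ltnS leq_double.
exists (maxn m1 (maxn m0.*2.+2 n.*2.*2.+2)); set m := maxn _ _.
have mm1 : m1 <= m by rewrite leq_maxl.
have mm0 : m0.*2.+2 <= m by rewrite /m !leq_max leqnn orbT.
have mn : n.*2.*2.+2 <= m by rewrite /m !leq_max leqnn !orbT.
have -> : g (mkseq s m) = if s 0 == 0 then v (mkseq s m)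
    else interleave (evens_word (simulate (v (mkseq s m)) (ws (mkseq s m)) k)) (ws
      (mkseq s m) k).
  by rewrite /g nth_mkseq // (leq_trans _ mn).
case: ifP => _.
  by apply: leq_trans (sv m mn); rewrite -addnn leq_addr.
rewrite size_mkseq -addnn; apply: leq_trans (leq_addr _ _).
rewrite leq_min size_mkseq geq_half_double; apply/andP; split.
  apply: h0 => //.
    by rewrite /v bE !size_mkseq geq_half_double -ltnS (ltn_predK mm0) ltnW.
  by move=> i ik; apply: leq_trans (h1 m mm1 i (ltnW ik)); exact: leq_maxl.
by apply: leq_trans (h1 m mm1 k (ltnSn k)); exact: leq_maxr.
Qed.

(** A program that reproduces itself and passes each answer on as the next query, so that iterating
    it applies the problem to its own answers. *)
Lemma idle_machine : exists2 c : baire, computable_fun (fun _ => c) & forall t,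
  Phi c t (bpair c t).
Proof.
pose pre s := bpair (constant_name (odds s)) (odds s).
pose post s := bpair (evens (evens s)) (odds s).
have cpre : computable_fun pre by apply: computable_fun_orec;
  rewrite /pre /constant_name; orec_tac.
have cpost : computable_fun post by apply: computable_fun_orec; rewrite /post; orec_tac.
have [N [cN _ _ NP]] := machine cpre cpost.
exists (N (fun _ => 0)).
  by apply: (@computable_fun_comp N (fun _ => _) cN); apply: computable_fun_const;
    rec_tac.
move=> t; have := NP (fun _ => 0) t t.
rewrite /pre /post !(evens_bpair, odds_bpair); apply.
by apply/U_bpair; exact: Phi_constant_name.
Qed.

(** * The climbing problem along a descending sequence *)

Section Climb.
Variable p : nat -> baire.
Hypothesis p_desc : descending p.
Let f := climb (fun n => deg (p n)).
Let F := realizer_version f.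

Lemma F_overwrite s t w : F s t -> F s (overwrite w t).
Proof. by rewrite /F !realizer_version_degrees deg_overwrite. Qed.

Lemma F_zero t n : deg t = deg (p n) -> F (fun _ => 0) t.
Proof.
by move=> tp; apply/realizer_version_degrees; rewrite tp; apply: Or33; split=> //;
  exists n.
Qed.

Lemma p_le m n : m <= n -> turing_le (p n) (p m).
Proof.
elim: n => [|n IH]; first by rewrite leqn0 => /eqP ->; exact: turing_le_refl.
rewrite leq_eqVlt => /predU1P[->|/IH]; first exact: turing_le_refl.
exact: turing_le_trans (proj1 (proj1 p_desc n)).
Qed.

Lemma p_lt m n : m < n -> ~ turing_le (p m) (p n).
Proof.
by move=> /p_le h h'; apply: (proj2 (proj1 p_desc m)); exact: turing_le_trans h' h.
Qed.

Lemma p_nonzero n : ~ turing_le (p n) (fun _ => 0).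
Proof.
move=> h; apply: (proj2 (proj1 p_desc n)); apply: turing_le_trans h _.
by apply: turing_le_rec; rec_tac.
Qed.

Lemma F_degree s t : F s t -> exists n, deg t = deg (p n).
Proof.
by move=> /realizer_version_degrees[[_ ->]|[n _ ->]|[_ [n ->]]];
  [exists 0 | exists n | exists n].
Qed.

Lemma F_dom s n : deg s = deg (p n) -> mdom F s.
Proof.
case: n => [|n] e.
  by exists (p 0); apply/realizer_version_degrees; rewrite e; exact: Or31.
by exists (p n); apply/realizer_version_degrees; rewrite e; apply: Or32; exists n.
Qed.

Lemma F_succ s t n : deg s = deg (p n.+1) -> F s t -> deg t = deg (p n).
Proof.
move=> e /realizer_version_degrees[[e0 _]|[m em ->]|[e0 _]].
- by move: e0; rewrite e => /deg_eq[_ /p_lt]; case.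
- move: em; rewrite e => /deg_eq[nm mn]; suff -> : n = m by [].
  by case: (ltngtP n m) => // lt; [case: (@p_lt n.+1 m.+1) | case: (@p_lt m.+1 n.+1)].
- by move: e0; rewrite e => /deg_eq[/p_nonzero].
Qed.

(** An answer costs one index. For the query 0 the degree of [p k.+1] may be chosen; a query of the
    degree of [p n.+1] below [p k.+2] forces [k < n], and the query [a 0] is excluded. Overwriting
    supplies the prefix [u]. *)
Lemma F_answer s k u : turing_le s (p k.+2) -> mdom F s ->
  exists t, [/\ F s t, initial u t & turing_le t (p k.+1)].
Proof.
have ow n : turing_le (overwrite u (p n)) (p n) by exact: turing_le_computable_fun
  (computable_fun_overwrite u).
move=> sp [t /realizer_version_degrees[[e _]|[n e _]|[e _]]].
- have /deg_eq[_ ps] := e; by case: (@p_lt 0 k.+2) => //; exact: turing_le_trans ps sp.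
- exists (overwrite u (p n)); split; last 2 first.
  + exact: initial_overwrite.
  + apply: turing_le_trans (ow n) _; apply: p_le; rewrite leqNgt; apply/negP => lt.
    have /deg_eq[_ ps] := e; case: (@p_lt n.+1 k.+2) => //.
    exact: turing_le_trans ps sp.
  apply: F_overwrite; apply/realizer_version_degrees; rewrite e.
  by apply: Or32; exists n.
- exists (overwrite u (p k.+1)); split; last 2 first.
  + exact: initial_overwrite.
  + exact: ow.
  apply: F_overwrite; apply/realizer_version_degrees; rewrite e.
  by apply: Or33; split=> //; exists k.+1.
Qed.

Lemma loop_computes c : (forall t, Phi c t (bpair c t)) ->
  let q0 := bpair c (fun _ => 0) in
  mdom (loop F) q0 /\ forall s, loop F q0 s -> turing_le (p 0) s.
Proof.
move=> cP q0.
have Pc t z : Phi c t z -> z = bpair c t by move=> /Phi_single_valued; apply.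
split; last first.
  move=> _ [_ [q [q00 step ->]]].
  have qE i : evens (q i) = c.
    case: i => [|i]; first by rewrite q00 evens_bpair.
    elim: i => [|i IH].
      by have /LE[_ [t _]] := step 0; rewrite q00 evens_bpair => /Pc ->;
        rewrite evens_bpair.
    by have /LE[_ [t _]] := step i.+1; rewrite IH => /Pc ->; rewrite evens_bpair.
  have Fq i : F (odds (q i)) (odds (q i.+1)).
    by have /LE[_ [t ft]] := step i; rewrite qE => /Pc ->; rewrite odds_bpair.
  have climbs n i : deg (odds (q i)) = deg (p n) -> deg (odds (q (i + n))) = deg (p 0).
    elim: n i => [|n IH] i e; first by rewrite addn0.
    by rewrite addnS -addSn; apply: IH; exact: F_succ e (Fq i).
  (* The query of state 1 is the first answer, of some degree [a n]; after [n] further states the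
     query has degree [a 0]. *)
  have [n en] := F_degree (Fq 0).
  have /deg_eq[_ h] := climbs n 1 en; apply: turing_le_trans h _.
  rewrite -[q (1 + n)](col_tuple q).
  apply: (@turing_le_computable_fun (fun s => odds (col s (1 + n)))).
  by apply: computable_fun_orec; orec_tac.
rewrite mdom_loop => i.
have inv z : reach F q0 i z -> evens z = c /\ mdom F (odds z).
  elim: i z => [_ ->|i IH z [y /IH[ey _] /LE[_ [t ft]]]].
    rewrite evens_bpair odds_bpair; split=> //; exists (p 0); exact: (@F_zero _ 0).
  rewrite ey => /Pc ->; rewrite evens_bpair odds_bpair; split=> //.
  by have [n /F_dom] := F_degree ft.
move=> z /inv[ez dz]; apply/mdom_LE; split=> // t _.
by rewrite ez; eexists; exact: cP.
Qed.

Lemma omega_avoids x : turing_le x (fun _ => 0) -> mdom (omega F) x ->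
  exists2 r, omega F x r & ~ turing_le (p 0) r.
Proof.
rewrite mdom_omega => x_comp dx.
have x_le z : turing_le x z.
  by apply: turing_le_trans x_comp _; apply: turing_le_rec; rec_tac.
(* The forcing is applied to sequences of answers rather than to components of omega, because
   answers may have arbitrary prefixes while the programs in the components are computed from
   them. *)
pose row n : set baire := fun b => if n is m.+1 then exists zs : nat -> baire,
  [/\ zs 0 = x,
      forall i, i < m -> F (odds (zs i)) (col b i) /\ Phi (evens (zs i)) (col b i) (zs
        i.+1) &
      F (odds (zs m)) (col b m)] else True.
have row_gamma n b : row n b -> exists2 r,
  gamma (scons n (bpair x b)) r & iterate F n x r.
  case: n => [_|m [zs [z0 run ans]]].
    exists x => //; exists (fun _ => x); split=> //.
    + by rewrite stl_scons evens_bpair.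
    + by rewrite /= stl_scons evens_bpair.
  exists (bpair (evens (zs m)) (col b m)).
    exists zs; rewrite stl_scons evens_bpair odds_bpair; split=> //= i /run[_ h].
    exact/U_bpair.
  have st i : i <= m -> stage F i x (zs i).
    elim: i => [_|i IH im]; first by rewrite z0.
    have [fi Pi] := run i im; exact: (stage_step dx (IH (ltnW im)) fi Pi).
  apply/(iterateSE dx); exists (zs m); rewrite evens_bpair odds_bpair; split=> //.
  exact: st.
(* The computable start lies below [p m.+2], and each of the [m] steps lowers the index by one. The
   last state is then below [p 2], so the remaining answer can be found below [p 1]. *)
have partial w m j : j <= m -> exists t zs : nat -> baire,
    [/\ zs 0 = x, forall i, i < j -> [/\ F (odds (zs i)) (t i),
      Phi (evens (zs i)) (t i) (zs i.+1),
           initial (col_word w i) (t i) & turing_le (t i) (p 1)],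
        stage F j x (zs j) & turing_le (zs j) (p (m.+2 - j))].
  elim: j => [_|j IH jm]; first by exists (fun _ => x), (fun _ => x); split=> //=;
    exact: x_le.
  have [t [zs [z0 run zj lej]]] := IH (ltnW jm).
  have e : m.+2 - j = (m - j.+1).+3 by rewrite subSn ?(leqW (ltnW jm)) // subSn ?(ltnW
    jm) // -(subnSK jm).
  have le_odds : turing_le (odds (zs j)) (p (m - j.+1).+3).
    by rewrite -e; apply: turing_le_trans lej;
      exact: turing_le_computable_fun computable_fun_odds.
  have [tj [ftj itj letj]] := F_answer (col_word w j) le_odds (stage_query dx zj).
  have [zj' Pzj'] := stage_answer dx zj ftj.
  exists (fun i => if i < j then t i else tj), (fun i => if i <= j then zs i else zj').
  split=> //.
  - move=> i; rewrite ltnS => ij0.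
    have /predU1P[->|ij] : (i == j) || (i < j) by rewrite -leq_eqVlt.
      rewrite leqnn ltnn; split=> //; apply: turing_le_trans letj _; exact: p_le.
    by rewrite ij (ltnW ij); exact: run.
  - by rewrite ltnn; exact: (stage_step dx zj ftj Pzj').
  - rewrite ltnn (_ : m.+2 - j.+1 = (m - j.+1).+2);
    last by rewrite subSn ?(leqW jm) // subSn.
    apply: (@turing_le_U (bpair (evens (zs j)) tj)); last exact/U_bpair.
    apply: turing_le_bpair => //; rewrite e in lej.
    apply: (@turing_le_trans (zs j));
      first exact: turing_le_computable_fun computable_fun_evens.
    by apply: turing_le_trans lej _; exact: p_le.
have dense n w : exists b, [/\ row n b, initial w b & turing_le b (p 1)].
  have ow z : turing_le (overwrite w (fun _ => 0)) z.
    by apply: turing_le_trans (turing_le_computable_fun _ (computable_fun_overwrite w))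
      _; apply: turing_le_rec; rec_tac.
  case: n => [|m].
    by exists (overwrite w (fun _ => 0)); split=> //; exact: initial_overwrite.
  have [t [zs [z0 run zm lem]]] := partial w m m (leqnn m).
  have le_odds : turing_le (odds (zs m)) (p 2).
    have -> : 2 = m.+2 - m by rewrite subSn ?leqnSn // subSnn.
    by apply: turing_le_trans lem; exact: turing_le_computable_fun computable_fun_odds.
  have [tm [ftm itm letm]] := F_answer (col_word w m) le_odds (stage_query dx zm).
  pose t' i := if i < m then t i else tm.
  exists (tuple_of (fun i => if i < m.+1 then t' i else col (overwrite w (fun _ =>
    0)) i)).
  have t'i i : i < m.+1 -> initial (col_word w i) (t' i) /\ turing_le (t' i) (p 1).
    rewrite ltnS leq_eqVlt /t' => /predU1P[->|im]; first by rewrite ltnn.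
    by rewrite im; have [] := run i im.
  split.
  - exists zs; rewrite col_tuple ltnSn /t' ltnn; split=> // i im.
    by rewrite col_tuple ltnS (ltnW im) im; have [] := run i im.
  - apply/initialP => l lw; rewrite /tuple_of; case: ifP => [lm|_].
      have [/initialP h _] := t'i _ lm.
      by rewrite -h ?size_col_word ?nth_col_word npair_surj.
    by rewrite /col npair_surj /overwrite lw.
  - by apply: turing_le_columns => [i /t'i[]|//].
have [beta [rows nbeta]] := avoid_cone dense (@p_lt 0 1 isT).
have /choice[r rP] n : exists r, gamma (scons n (bpair x (beta n))) r /\ iterate F n x r.
  by have [r h1 h2] := row_gamma n _ (rows n); exists r.
exists (tuple_of r); first by exists r => // n; have [] := rP n.
move=> le; apply: nbeta; apply: turing_le_trans le _.
(* [gamma] rebuilds the components of [r] from the rows of [beta] uniformly in [n], so [r] is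
   computable from [beta] and cannot compute [p 0] either. *)
pose D s := tuple_of (fun n => scons n (bpair (evens s) (col (odds s) n))).
have cD : computable_fun D by apply: computable_fun_orec; rewrite /D; orec_tac.
apply: (@turing_le_trans (D (bpair x (tuple_of beta)))).
  exists (parallel gamma); first exact: computable_parallel computable_gamma.
  by move=> n; rewrite /D !col_tuple evens_bpair odds_bpair col_tuple; have [] := rP n.
apply: turing_le_trans (turing_le_computable_fun _ cD) _.
exact: turing_le_bpair (x_le _) (turing_le_refl _).
Qed.

(** The outer functional also sees the input, but the input [q0] is computable, so the value of
    omega at the computable point given by [K] would have to compute [p 0] alone. *)
Lemma loop_not_le_omega : ~ leW (infinite_loop f) (omega_problem f).
Proof.
move=> [H [K [cH cK red]]].
have [c cc cP] := idle_machine.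
pose q0 := bpair c (fun _ => 0).
have cq0 : computable_fun (fun _ => q0).
  by apply: (computable_fun_bpair cc); apply: computable_fun_const; rec_tac.
have q0_le z : turing_le q0 z by exact: turing_le_computable_fun cq0.
have [dq0 loop_p0] := loop_computes cP.
have use sel : (forall y, mdom (omega F) y -> omega F y (sel y)) -> exists k,
    [/\ K q0 k, mdom (omega F) k & turing_le (p 0) (sel k)].
  move=> selP.
  have real : realizes (fun y => [set r | mdom (omega F) y /\ r = sel y])
    (omega_problem f).
    split; first by move=> y r s [_ ->] [_ ->].
    rewrite /= mcomp_mid => y dy; exists (sel y); last exact: selP.
    by split; [move=> r _; exists r | exists (sel y)].
  have [_ /(_ q0)] := red _ real; rewrite /= mcomp_mid => /(_ dq0)[y [_ [y' + yE]]].
  rewrite /mid /= in yE; rewrite -{}yE.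
  move=> [_ [_ [_ [r [-> [_ [k Kk [dk ->]]] ->]]] Hy]] ly.
  exists k; split=> //; apply: turing_le_trans (loop_p0 _ ly) _.
  apply: (@turing_le_trans (bpair q0 (sel k))); first by exists H.
  exact: turing_le_bpair (q0_le _) (turing_le_refl _).
have /choice[sel selP] y : exists r, mdom (omega F) y -> omega F y r.
  by have [[r yr]|ny] := pselect (mdom (omega F) y); [exists r | exists y].
have [k [Kk dk _]] := use sel selP.
have k_comp : turing_le k (fun _ => 0).
  by apply: turing_le_trans (q0_le _); exists K.
have [R kR nR] := omega_avoids k_comp dk.
(* The realizer is changed at the single point [k], where it now returns the value that does not
   compute [p 0]. *)
have [y dy|k' [Kk' _]] := use (fun y => if `[< y = k >] then R else sel y).
  by case: ifP => [/asboolP ->|_] //; exact: selP.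
rewrite (computable_single_valued cK Kk' Kk).
by case: ifP => [_ //|/asboolP].
Qed.

End Climb.

Theorem mainTheorem6 :
  (exists p : nat -> baire, descending p) /\
  (forall p : nat -> baire, descending p ->
     let f := climb (fun n => deg (p n)) in
     ~ leW (infinite_loop f) (omega_problem f) /\
     equivsW (omega_problem f) (parallelization (diamond_problem f))).
Proof.
split=> [|p p_desc f]; first exact: descending_exists.
split; first exact: loop_not_le_omega.
split; first exact: omega_le_diamond.
apply: diamond_le_omega; first exact: F_overwrite.
by exists (p 0); exact: (@F_zero _ _ 0).
Qed.
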